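(* Let $\ell\in\mathbf N$ and let $\lambda\in P^+$ be non-zero. There is an isomorphism of graded $\mathfrak g[t]$-modules $V(\boldsymbol\xi(\ell,\lambda))\cong D(\ell,\lambda)$. Equivalently, $D(\ell,\lambda)$ is the quotient of $W_{\rm loc}(\lambda)$ by the submodule generated by the elements $$\{(x^-_\alpha\otimes t^{s_\alpha})w_\lambda:\ \alpha\in R^+\}\ \cup\ \{(x_\alpha^-\otimes t^{s_\alpha-1})^{m_\alpha+1}w_\lambda:\ \alpha\in R^+,\ \lambda(h_\alpha)>0,\ m_\alpha<d_\alpha\ell\}.$$
   Context: $\mathbf Z_+$ is the set of non-negative integers, $\mathbf N$ the positive integers. $\mathfrak g$ is a simple finite-dimensional complex Lie algebra with Cartan subalgebra $\mathfrak h$, root system $R$, simple roots $\alpha_i$ ($i\in I=\{1,\dots,n\}$), positive roots $R^+$, dominant integral weights $P^+$. The form $(\ ,\ )$ on $\mathfrak h^*$ is normalized so that long roots have square length $2$, and $d_\alpha=2/(\alpha,\alpha)$. For $\alpha\in R^+$, $h_\alpha$ is the coroot and $x^\pm_\alpha\in\mathfrak g_{\pm\alpha}$ are non-zero root vectors with $[h_\alpha,x_\alpha^\pm]=\pm2x_\alpha^\pm$, $[x^+_\alpha,x^-_\alpha]=h_\alpha$; $x_i^\pm=x^\pm_{\alpha_i}$, $h_i=h_{\alpha_i}$. The current algebra is $\mathfrak g[t]=\mathfrak g\otimes\mathbf C[t]$, graded by degree in $t$; morphisms of graded modules have degree zero. For $\lambda\in P^+$ the local Weyl module $W_{\rm loc}(\lambda)$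 is the $\mathfrak g[t]$-module generated by $w_\lambda$ (in grade $0$) with defining relations $(x_i^+\otimes\mathbf C[t])w_\lambda=0$, $(h_i\otimes t^s)w_\lambda=\lambda(h_i)\delta_{s,0}w_\lambda$, $(x_i^-\otimes1)^{\lambda(h_i)+1}w_\lambda=0$ for $i\in I$, $s\in\mathbf Z_+$. For a family $\boldsymbol\xi=(\xi^\alpha)_{\alpha\in R^+}$ of partitions $\xi^\alpha=(\xi^\alpha_1\ge\xi^\alpha_2\ge\cdots\ge0)$ with $\sum_{j}\xi^\alpha_j=\lambda(h_\alpha)$, $V(\boldsymbol\xi)$ is the quotient of $W_{\rm loc}(\lambda)$ by the submodule generated by all elements $(x_\alpha^+\otimes t)^s(x_\alpha^-\otimes1)^{s+r}w_\lambda$ with $\alpha\in R^+$, $s,r\in\mathbf N$ such that $s+r\ge1+rk+\sum_{j\ge k+1}\xi^\alpha_j$ for some $k\in\mathbf N$. Given $\ell\in\mathbf N$ and non-zero $\lambda\in P^+$: for $\alpha\in R^+$ with $\lambda(h_\alpha)>0$ let $s_\alpha,m_\alpha\in\mathbf N$ be the unique integers with $\lambda(h_\alpha)=(s_\alpha-1)d_\alpha\ell+m_\alpha$, $0<m_\alpha\le d_\alpha\ell$; if $\lambda(h_\alpha)=0$ set $s_\alpha=m_\alpha=0$. Then $\boldsymbol\xi(\ell,\lambda)=(\xi^\alpha)_{\alpha\in R^+}$, where $\xi^\alpha$ is empty if $\lambda(h_\alpha)=0$ and otherwise $\xi^\alpha$ has $s_\alpha-1$ parts equal to $d_\alpha\ell$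 followed by one part $m_\alpha$. The Demazure module $D(\ell,\lambda)$ is the quotient of $W_{\rm loc}(\lambda)$ by the submodule generated by the elements $(x_\alpha^-\otimes t^p)^{r+1}w_\lambda$ for $\alpha\in R^+$, $p\in\mathbf Z_+$, $r\ge\max\{0,\lambda(h_\alpha)-d_\alpha\ell p\}$. *)

(* Defs.v *)
From HB Require Import structures.
From mathcomp Require Import all_boot all_order all_algebra.
From mathcomp Require Import complex zify.
From mathcomp Require Import boolp classical_sets functions reals.

Set Implicit Arguments.
Unset Strict Implicit.
Unset Printing Implicit Defensive.

Import Order.TTheory GRing.Theory Num.Theory.
Local Open Scope classical_set_scope.
Local Open Scope quotient_scope.
Local Open Scope ring_scope.

HB.mixin Record isLieAlgebra (K : fieldType) L of GRing.Lmodule K L := {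
  lie : L -> L -> L;
  lieDl : forall x y z, lie (x + y) z = lie x z + lie y z;
  lieDr : forall x y z, lie x (y + z) = lie x y + lie x z;
  lieZl : forall a x y, lie (a *: x) y = a *: lie x y;
  lieZr : forall a x y, lie x (a *: y) = a *: lie x y;
  liexx : forall x, lie x x = 0;
  lie_jacobi : forall x y z,
    lie x (lie y z) + lie y (lie z x) + lie z (lie x y) = 0 }.

#[short(type="lieAlgType")]
HB.structure Definition LieAlgebra (K : fieldType) :=
  { L of GRing.Lmodule K L & isLieAlgebra K L }.

#[short(type="fdLieAlgType")]
HB.structure Definition FdLieAlgebra (K : fieldType) :=
  { L of Vector K L & isLieAlgebra K L }.

HB.mixin Record isLieModule (K : fieldType) (L : lieAlgType K) M
    of GRing.Lmodule K M := {
  act : L -> M -> M;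
  actDl : forall x y v, act (x + y) v = act x v + act y v;
  actDr : forall x u v, act x (u + v) = act x u + act x v;
  actZl : forall a x v, act (a *: x) v = a *: act x v;
  actZr : forall a x v, act x (a *: v) = a *: act x v;
  act_lie : forall x y v,
    act (lie x y) v = act x (act y v) - act y (act x v) }.

#[short(type="lieModType")]
HB.structure Definition LieModule (K : fieldType) (L : lieAlgType K) :=
  { M of GRing.Lmodule K M & isLieModule K L M }.

Section LieTheory.
Variables (K : fieldType) (L : lieAlgType K).

Lemma lie0x (x : L) : lie 0 x = 0.
Proof. by have := lieZl 0 0 x; rewrite !scale0r. Qed.
Lemma liex0 (x : L) : lie x 0 = 0.
Proof. by have := lieZr 0 x 0; rewrite !scale0r. Qed.
Lemma lieNx (x y : L) : lie (- x) y = - lie x y.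
Proof. by rewrite -scaleN1r lieZl scaleN1r. Qed.
Lemma liexN (x y : L) : lie x (- y) = - lie x y.
Proof. by rewrite -scaleN1r lieZr scaleN1r. Qed.
Lemma lieC (x y : L) : lie x y = - lie y x.
Proof.
apply/eqP; rewrite -addr_eq0; apply/eqP.
by have := liexx (x + y); rewrite lieDl !lieDr !liexx addr0 add0r.
Qed.
Lemma lie_suml I (r : seq I) P (F : I -> L) y :
  lie (\sum_(i <- r | P i) F i) y = \sum_(i <- r | P i) lie (F i) y.
Proof. exact: (big_morph (lie^~ y) (fun a b => lieDl a b y) (lie0x y)). Qed.
Lemma lie_sumr I (r : seq I) P (F : I -> L) y :
  lie y (\sum_(i <- r | P i) F i) = \sum_(i <- r | P i) lie y (F i).
Proof. exact: (big_morph (lie y) (fun a b => lieDr y a b) (liex0 y)). Qed.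

End LieTheory.

Definition lie_hom (K : fieldType) (L : lieAlgType K) (M N : lieModType L)
    (f : M -> N) : Prop :=
  linear f /\ forall x v, f (act x v) = act x (f v).

Section Submodule.
Variables (K : fieldType) (L : lieAlgType K) (M : lieModType L).

Inductive gen_submod (S : set M) : set M :=
| gen_submod_in v : S v -> gen_submod S v
| gen_submod0 : gen_submod S 0
| gen_submodD u v : gen_submod S u -> gen_submod S v -> gen_submod S (u + v)
| gen_submodZ a v : gen_submod S v -> gen_submod S (a *: v)
| gen_submod_act x v : gen_submod S v -> gen_submod S (act x v).

Variable S : set M.

(* quot_mod S is M modulo the submodule generated by S, not modulo S itself. *)
Definition qequiv (u v : M) : bool := `[< gen_submod S (u - v) >].

Lemma qequiv_equiv : equiv_class_of qequiv.
Proof.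
have N u : gen_submod S u -> gen_submod S (- u).
  by rewrite -scaleN1r; apply: gen_submodZ.
split=> [u|u v|v u w].
- by apply/asboolP; rewrite subrr; constructor.
- by apply/asboolP/asboolP => /N; rewrite opprB.
- move=> /asboolP h1 /asboolP h2; apply/asboolP.
  by rewrite -(subrK v u) -addrA; apply: gen_submodD.
Qed.
Canonical qequiv_equivRel := EquivRelPack qequiv_equiv.
Canonical qequiv_enc := defaultEncModRel qequiv.

Definition quot_mod := {eq_quot qequiv}.
HB.instance Definition _ : EqQuotient M qequiv quot_mod :=
  EqQuotient.on quot_mod.
HB.instance Definition _ := Choice.on quot_mod.

Local Notation Q := quot_mod.

Definition proj_mod (v : M) : Q := \pi_Q v.

Lemma proj_modP u v : proj_mod u = proj_mod v <-> gen_submod S (u - v).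
Proof.
split=> [/eqmodP/asboolP //|h]; by apply/eqmodP/asboolP.
Qed.

Lemma repr_modP v : gen_submod S (repr (proj_mod v) - v).
Proof. by apply/proj_modP; rewrite /proj_mod reprK. Qed.

Definition qadd (u v : Q) : Q := proj_mod (repr u + repr v).
Definition qopp (u : Q) : Q := proj_mod (- repr u).
Definition qscale (a : K) (u : Q) : Q := proj_mod (a *: repr u).
Definition qact (x : L) (u : Q) : Q := proj_mod (act x (repr u)).

Lemma qaddE u v : qadd (proj_mod u) (proj_mod v) = proj_mod (u + v).
Proof.
apply/proj_modP; rewrite opprD addrACA.
by apply: gen_submodD; apply: repr_modP.
Qed.
Lemma qscaleE a u : qscale a (proj_mod u) = proj_mod (a *: u).
Proof.
by apply/proj_modP; rewrite -scalerBr; apply/gen_submodZ/repr_modP.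
Qed.
Lemma qoppE u : qopp (proj_mod u) = proj_mod (- u).
Proof.
rewrite -(scaleN1r u) -qscaleE /qopp /qscale.
by rewrite scaleN1r.
Qed.
Lemma qactE x u : qact x (proj_mod u) = proj_mod (act x u).
Proof.
apply/proj_modP; rewrite -scaleN1r -actZr -actDr scaleN1r.
exact/gen_submod_act/repr_modP.
Qed.

Lemma proj_mod_surj (u : Q) : exists v, u = proj_mod v.
Proof. by exists (repr u); rewrite /proj_mod reprK. Qed.

Fact qaddA : associative qadd.
Proof.
move=> u v w; have [a ->] := proj_mod_surj u; have [b ->] := proj_mod_surj v.
by have [c ->] := proj_mod_surj w; rewrite !qaddE addrA.
Qed.
Fact qaddC : commutative qadd.
Proof.
move=> u v; have [a ->] := proj_mod_surj u; have [b ->] := proj_mod_surj v.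
by rewrite !qaddE addrC.
Qed.
Fact qadd0 : left_id (proj_mod 0) qadd.
Proof. by move=> u; have [a ->] := proj_mod_surj u; rewrite !qaddE add0r. Qed.
Fact qaddN : left_inverse (proj_mod 0) qopp qadd.
Proof.
by move=> u; have [a ->] := proj_mod_surj u; rewrite qoppE qaddE addNr.
Qed.
HB.instance Definition _ := GRing.isZmodule.Build Q qaddA qaddC qadd0 qaddN.

Lemma proj_modD u v : proj_mod (u + v) = proj_mod u + proj_mod v.
Proof. by rewrite -qaddE. Qed.

Fact qscaleA a b u : qscale a (qscale b u) = qscale (a * b) u.
Proof. by have [v ->] := proj_mod_surj u; rewrite !qscaleE scalerA. Qed.
Fact qscale1 : left_id 1 qscale.
Proof. by move=> u; have [v ->] := proj_mod_surj u; rewrite qscaleE scale1r. Qed.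
Fact qscaleDr : right_distributive qscale +%R.
Proof.
move=> a u v; have [b ->] := proj_mod_surj u; have [c ->] := proj_mod_surj v.
by rewrite -proj_modD !qscaleE scalerDr proj_modD.
Qed.
Fact qscaleDl u a b : qscale (a + b) u = qscale a u + qscale b u.
Proof.
by have [v ->] := proj_mod_surj u; rewrite !qscaleE scalerDl proj_modD.
Qed.
HB.instance Definition _ :=
  GRing.Zmodule_isLmodule.Build K Q qscaleA qscale1 qscaleDr qscaleDl.

Lemma proj_modZ a u : proj_mod (a *: u) = a *: proj_mod u.
Proof. by rewrite -qscaleE. Qed.
Lemma proj_modN u : proj_mod (- u) = - proj_mod u.
Proof. by rewrite -scaleN1r proj_modZ scaleN1r. Qed.

Fact qactDl x y u : qact (x + y) u = qact x u + qact y u.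
Proof. by have [v ->] := proj_mod_surj u; rewrite !qactE actDl proj_modD. Qed.
Fact qactDr x u v : qact x (u + v) = qact x u + qact x v.
Proof.
have [b ->] := proj_mod_surj u; have [c ->] := proj_mod_surj v.
by rewrite -proj_modD !qactE actDr proj_modD.
Qed.
Fact qactZl a x u : qact (a *: x) u = a *: qact x u.
Proof. by have [v ->] := proj_mod_surj u; rewrite !qactE actZl proj_modZ. Qed.
Fact qactZr a x u : qact x (a *: u) = a *: qact x u.
Proof.
by have [v ->] := proj_mod_surj u; rewrite -proj_modZ !qactE actZr proj_modZ.
Qed.
Fact qact_lie x y u : qact (lie x y) u = qact x (qact y u) - qact y (qact x u).
Proof.
have [v ->] := proj_mod_surj u.
by rewrite !qactE act_lie proj_modD proj_modN.
Qed.
HB.instance Definition _ :=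
  isLieModule.Build K L Q qactDl qactDr qactZl qactZr qact_lie.

Lemma proj_mod_act x u : proj_mod (act x u) = act x (proj_mod u).
Proof. by rewrite -qactE. Qed.

Lemma proj_mod_eq0 u : proj_mod u = 0 <-> gen_submod S u.
Proof. by rewrite -[u in gen_submod _ u]subr0; apply: proj_modP. Qed.

End Submodule.

(* The free L-module on one generator (U(L) as a left module), as formal
   module expressions in the generator modulo the module axioms.            *)

Section FreeModule.
Variables (K : fieldType) (L : lieAlgType K).

Inductive mterm : Type :=
| TGen
| TZero
| TAdd of mterm & mterm
| TScale of K & mterm
| TAct of L & mterm.

Inductive meq : mterm -> mterm -> Prop :=
| meq_refl u : meq u u
| meq_sym u v : meq u v -> meq v u
| meq_trans v u w : meq u v -> meq v w -> meq u w
| meq_add u u' v v' : meq u u' -> meq v v' -> meq (TAdd u v) (TAdd u' v')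
| meq_scale a u u' : meq u u' -> meq (TScale a u) (TScale a u')
| meq_act x u u' : meq u u' -> meq (TAct x u) (TAct x u')
| meq_addA u v w : meq (TAdd u (TAdd v w)) (TAdd (TAdd u v) w)
| meq_addC u v : meq (TAdd u v) (TAdd v u)
| meq_add0 u : meq (TAdd TZero u) u
| meq_addN u : meq (TAdd (TScale (-1) u) u) TZero
| meq_scaleA a b u : meq (TScale a (TScale b u)) (TScale (a * b) u)
| meq_scale1 u : meq (TScale 1 u) u
| meq_scaleDr a u v :
    meq (TScale a (TAdd u v)) (TAdd (TScale a u) (TScale a v))
| meq_scaleDl a b u : meq (TScale (a + b) u) (TAdd (TScale a u) (TScale b u))
| meq_actDl x y u : meq (TAct (x + y) u) (TAdd (TAct x u) (TAct y u))
| meq_actDr x u v : meq (TAct x (TAdd u v)) (TAdd (TAct x u) (TAct x v))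
| meq_actZl a x u : meq (TAct (a *: x) u) (TScale a (TAct x u))
| meq_actZr a x u : meq (TAct x (TScale a u)) (TScale a (TAct x u))
| meq_act_lie x y u :
    meq (TAct (lie x y) u)
        (TAdd (TAct x (TAct y u)) (TScale (-1) (TAct y (TAct x u)))).

HB.instance Definition _ := gen_eqMixin mterm.
HB.instance Definition _ := gen_choiceMixin mterm.

Definition meqb u v : bool := `[< meq u v >].

Lemma meqb_equiv : equiv_class_of meqb.
Proof.
split=> [u|u v|v u w].
- exact/asboolP/meq_refl.
- by apply/asboolP/asboolP => /meq_sym.
- move=> /asboolP h1 /asboolP h2; apply/asboolP; exact: meq_trans h1 h2.
Qed.
Canonical meqb_equivRel := EquivRelPack meqb_equiv.
Canonical meqb_enc := defaultEncModRel meqb.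

Definition free_mod := {eq_quot meqb}.
HB.instance Definition _ : EqQuotient mterm meqb free_mod :=
  EqQuotient.on free_mod.
HB.instance Definition _ := Choice.on free_mod.

Local Notation F := free_mod.

Definition tcls (u : mterm) : F := \pi_F u.

Lemma tclsP u v : tcls u = tcls v <-> meq u v.
Proof. by split=> [/eqmodP/asboolP //|h]; apply/eqmodP/asboolP. Qed.
Lemma repr_tcls u : meq (repr (tcls u)) u.
Proof. by apply/tclsP; rewrite /tcls reprK. Qed.
Lemma tcls_surj (u : F) : exists v, u = tcls v.
Proof. by exists (repr u); rewrite /tcls reprK. Qed.

Definition fadd (u v : F) : F := tcls (TAdd (repr u) (repr v)).
Definition fscale (a : K) (u : F) : F := tcls (TScale a (repr u)).
Definition fopp (u : F) : F := fscale (-1) u.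
Definition fact (x : L) (u : F) : F := tcls (TAct x (repr u)).

Lemma faddE u v : fadd (tcls u) (tcls v) = tcls (TAdd u v).
Proof. by apply/tclsP/meq_add; apply: repr_tcls. Qed.
Lemma fscaleE a u : fscale a (tcls u) = tcls (TScale a u).
Proof. exact/tclsP/meq_scale/repr_tcls. Qed.
Lemma factE x u : fact x (tcls u) = tcls (TAct x u).
Proof. exact/tclsP/meq_act/repr_tcls. Qed.

Fact faddA : associative fadd.
Proof.
move=> u v w; have [a ->] := tcls_surj u; have [b ->] := tcls_surj v.
by have [c ->] := tcls_surj w; rewrite !faddE; apply/tclsP/meq_addA.
Qed.
Fact faddC : commutative fadd.
Proof.
move=> u v; have [a ->] := tcls_surj u; have [b ->] := tcls_surj v.
by rewrite !faddE; apply/tclsP/meq_addC.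
Qed.
Fact fadd0 : left_id (tcls TZero) fadd.
Proof.
by move=> u; have [a ->] := tcls_surj u; rewrite faddE; apply/tclsP/meq_add0.
Qed.
Fact faddN : left_inverse (tcls TZero) fopp fadd.
Proof.
move=> u; have [a ->] := tcls_surj u; rewrite /fopp fscaleE faddE.
exact/tclsP/meq_addN.
Qed.
HB.instance Definition _ := GRing.isZmodule.Build F faddA faddC fadd0 faddN.

Lemma tclsD u v : tcls (TAdd u v) = tcls u + tcls v.
Proof. by rewrite -faddE. Qed.

Fact fscaleA a b u : fscale a (fscale b u) = fscale (a * b) u.
Proof.
by have [v ->] := tcls_surj u; rewrite !fscaleE; apply/tclsP/meq_scaleA.
Qed.
Fact fscale1 : left_id 1 fscale.
Proof.
by move=> u; have [v ->] := tcls_surj u; rewrite fscaleE; apply/tclsP/meq_scale1.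
Qed.
Fact fscaleDr : right_distributive fscale +%R.
Proof.
move=> a u v; have [b ->] := tcls_surj u; have [c ->] := tcls_surj v.
by rewrite -tclsD !fscaleE -tclsD; apply/tclsP/meq_scaleDr.
Qed.
Fact fscaleDl u a b : fscale (a + b) u = fscale a u + fscale b u.
Proof.
have [v ->] := tcls_surj u; rewrite !fscaleE -tclsD.
exact/tclsP/meq_scaleDl.
Qed.
HB.instance Definition _ :=
  GRing.Zmodule_isLmodule.Build K F fscaleA fscale1 fscaleDr fscaleDl.

Lemma tclsZ a u : tcls (TScale a u) = a *: tcls u.
Proof. by rewrite -fscaleE. Qed.

Fact factDl x y u : fact (x + y) u = fact x u + fact y u.
Proof.
have [v ->] := tcls_surj u; rewrite !factE -tclsD; exact/tclsP/meq_actDl.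
Qed.
Fact factDr x u v : fact x (u + v) = fact x u + fact x v.
Proof.
have [b ->] := tcls_surj u; have [c ->] := tcls_surj v.
by rewrite -tclsD !factE -tclsD; apply/tclsP/meq_actDr.
Qed.
Fact factZl a x u : fact (a *: x) u = a *: fact x u.
Proof.
have [v ->] := tcls_surj u; rewrite !factE -tclsZ; exact/tclsP/meq_actZl.
Qed.
Fact factZr a x u : fact x (a *: u) = a *: fact x u.
Proof.
have [v ->] := tcls_surj u; rewrite -tclsZ !factE -tclsZ.
exact/tclsP/meq_actZr.
Qed.
Fact fact_lie x y u : fact (lie x y) u = fact x (fact y u) - fact y (fact x u).
Proof.
have [v ->] := tcls_surj u; rewrite !factE -scaleN1r -tclsZ -tclsD.
exact/tclsP/meq_act_lie.
Qed.
HB.instance Definition _ :=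
  isLieModule.Build K L F factDl factDr factZl factZr fact_lie.

Definition free_gen : F := tcls TGen.

Lemma tclsA x u : tcls (TAct x u) = act x (tcls u).
Proof. by rewrite -factE. Qed.

Fixpoint meval (M : lieModType L) (m : M) (u : mterm) : M :=
  match u with
  | TGen => m
  | TZero => 0
  | TAdd u v => meval m u + meval m v
  | TScale a u => a *: meval m u
  | TAct x u => act x (meval m u)
  end.

Lemma meval_meq (M : lieModType L) (m : M) u v :
  meq u v -> meval m u = meval m v.
Proof.
elim=> //= {u v} *; try congruence.
- exact: addrA.
- exact: addrC.
- exact: add0r.
- by rewrite scaleN1r addNr.
- exact: scalerA.
- exact: scale1r.
- exact: scalerDr.
- exact: scalerDl.
- exact: actDl.
- exact: actDr.
- exact: actZl.
- exact: actZr.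
- by rewrite act_lie scaleN1r.
Qed.

Lemma free_mod_universal (M : lieModType L) (m : M) :
  exists! f : F -> M, lie_hom f /\ f free_gen = m.
Proof.
pose f (u : F) := meval m (repr u).
have fE u : f (tcls u) = meval m u by apply: meval_meq; apply: repr_tcls.
exists f; split.
  split; last exact: fE.
  split=> [a u v|x u].
    have [b ->] := tcls_surj u; have [c ->] := tcls_surj v.
    by rewrite -tclsZ -tclsD !fE.
  by have [b ->] := tcls_surj u; rewrite -tclsA !fE.
move=> h [[hl ha] hm]; apply/funext => u; have [t ->] := tcls_surj u.
have h0 : h 0 = 0 by have := hl (-1) 0 0; rewrite scaler0 add0r scaleN1r addNr.
rewrite fE; elim: t => [|| u1 e1 u2 e2| a u1 e1| x u1 e1] /=.
- by rewrite -hm.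
- by rewrite -h0.
- by rewrite e1 e2 tclsD; have := hl 1 (tcls u1) (tcls u2); rewrite !scale1r.
- by rewrite e1 tclsZ; have := hl a (tcls u1) 0; rewrite h0 !addr0.
- by rewrite e1 tclsA ha.
Qed.

End FreeModule.
Arguments free_gen {K L}.

(* The current algebra g[t] = g (x) C[t]: polynomials in t with coefficients
   in g, i.e. finitely supported sequences nat -> g.                        *)

Section Current.
Variables (K : numFieldType) (g : lieAlgType K).

Definition finsupp : {pred nat -> g} :=
  fun f => `[< exists N, forall n, (N <= n)%N -> f n = 0 >].

Lemma finsuppP (f : nat -> g) :
  reflect (exists N, forall n, (N <= n)%N -> f n = 0) (f \in finsupp).
Proof. exact: asboolP. Qed.

Fact finsupp_submod : submod_closed finsupp.
Proof.
split; first by apply/finsuppP; exists 0%N.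
move=> a u v /finsuppP[N hN] /finsuppP[N' hN']; apply/finsuppP.
exists (maxn N N') => n; rewrite geq_max => /andP[h h'].
by rewrite !fctE hN // hN' // scaler0 addr0.
Qed.
HB.instance Definition _ :=
  GRing.isSubmodClosed.Build K (nat -> g) finsupp finsupp_submod.

Record current := Current { cfun :> nat -> g; cfunP : cfun \in finsupp }.
HB.instance Definition _ := [isSub for cfun].
HB.instance Definition _ := [Choice of current by <:].
HB.instance Definition _ := [SubChoice_isSubLmodule of current by <:].

Lemma current_eq (u v : current) : (forall n, u n = v n) -> u = v.
Proof. by move=> h; apply/val_inj/funext. Qed.

Lemma cfunD (u v : current) n : (u + v) n = u n + v n.
Proof. by have /(congr1 (@^~ n)) := raddfD (val : current -> _) u v. Qed.
Lemma cfunZ a (u : current) n : (a *: u) n = a *: u n.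
Proof. by have /(congr1 (@^~ n)) := linearZ_LR (val : current -> _) a u. Qed.
Lemma cfun0 n : (0 : current) n = 0.
Proof. by have /(congr1 (@^~ n)) := raddf0 (val : current -> _). Qed.

Definition clie_fun (u v : current) (n : nat) : g :=
  \sum_(i < n.+1) lie (u i) (v (n - i)%N).

Lemma clie_sup (u v : current) : clie_fun u v \in finsupp.
Proof.
have /finsuppP[N hN] := cfunP u; have /finsuppP[N' hN'] := cfunP v.
apply/finsuppP; exists (N + N')%N => n hn; apply: big1 => i _.
have [h|h] := leqP N i; first by rewrite hN // lie0x.
by rewrite hN' ?liex0 // leq_subRL; lia.
Qed.

Definition clie (u v : current) : current := Current (clie_sup u v).

Lemma clieE (u v : current) B n : (n < B)%N ->
  clie u v n = \sum_(i < B) \sum_(j < B | (i + j == n)%N) lie (u i) (v j).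
Proof.
move=> hB; rewrite /= /clie_fun.
rewrite (big_ord_widen B (fun i => lie (u i) (v (n - i)%N))) //.
rewrite big_mkcond; apply: eq_bigr => i _.
case: ifP => hi.
  have hj : (n - i < B)%N by lia.
  rewrite (big_pred1 (Ordinal hj)) // => j /=; rewrite -val_eqE /=; lia.
by rewrite big1 // => j; lia.
Qed.

Fact clieDl u v w : clie (u + v) w = clie u w + clie v w.
Proof.
apply: current_eq => n; rewrite cfunD /= /clie_fun -big_split.
by apply: eq_bigr => i _; rewrite cfunD lieDl.
Qed.
Fact clieDr u v w : clie u (v + w) = clie u v + clie u w.
Proof.
apply: current_eq => n; rewrite cfunD /= /clie_fun -big_split.
by apply: eq_bigr => i _; rewrite cfunD lieDr.
Qed.
Fact clieZl a u v : clie (a *: u) v = a *: clie u v.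
Proof.
apply: current_eq => n; rewrite cfunZ /= /clie_fun scaler_sumr.
by apply: eq_bigr => i _; rewrite cfunZ lieZl.
Qed.
Fact clieZr a u v : clie u (a *: v) = a *: clie u v.
Proof.
apply: current_eq => n; rewrite cfunZ /= /clie_fun scaler_sumr.
by apply: eq_bigr => i _; rewrite cfunZ lieZr.
Qed.
Fact cliexx u : clie u u = 0.
Proof.
apply: current_eq => n; rewrite cfun0 (clieE _ _ (ltnSn n)).
set S := \sum_(i < _) _.
have : S = - S.
  rewrite {1}/S (exchange_big_dep xpredT) //= /S -sumrN; apply: eq_bigr => i _.
  rewrite -sumrN; apply: eq_big => [j|j _]; first by rewrite addnC.
  exact: lieC.
move/eqP; rewrite -subr_eq0 opprK -mulr2n -scaler_nat scaler_eq0 pnatr_eq0 /=.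
by move/eqP.
Qed.

Lemma clie3E (u v w : current) n :
  clie u (clie v w) n =
  \sum_(i < n.+1) \sum_(j < n.+1) \sum_(k < n.+1 | (i + j + k == n)%N)
     lie (u i) (lie (v j) (w k)).
Proof.
rewrite (clieE _ _ (ltnSn n)); apply: eq_bigr => i _.
transitivity (\sum_(m < n.+1 | (i + m == n)%N) \sum_(j < n.+1)
    \sum_(k < n.+1 | (j + k == m)%N) lie (u i) (lie (v j) (w k))).
  apply: eq_bigr => m _; rewrite (clieE _ _ (ltn_ord m)).
  rewrite lie_sumr; apply: eq_bigr => j _.
  by rewrite lie_sumr.
rewrite exchange_big; apply: eq_bigr => j _.
rewrite (exchange_big_dep xpredT) //= [RHS]big_mkcond; apply: eq_bigr => k _.
case: ifP => h.
  have hm : (j + k < n.+1)%N by lia.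
  rewrite (big_pred1 (Ordinal hm)) // => m /=; rewrite -val_eqE /=; lia.
by rewrite big1 // => m; lia.
Qed.

Fact clie_jacobi u v w :
  clie u (clie v w) + clie v (clie w u) + clie w (clie u v) = 0.
Proof.
apply: current_eq => n; rewrite !cfunD cfun0 !clie3E.
rewrite (_ : \sum_(i < _) \sum_(j < _)
             \sum_(k < _ | _) lie (v i) (lie (w j) (u k)) =
  \sum_(i < n.+1) \sum_(j < n.+1) \sum_(k < n.+1 | (i + j + k == n)%N)
     lie (v j) (lie (w k) (u i))); last first.
  under [LHS]eq_bigr do under eq_bigr do rewrite big_mkcond.
  under [RHS]eq_bigr do under eq_bigr do rewrite big_mkcond.
  rewrite [RHS]exchange_big; apply: eq_bigr => i _ /=.
  rewrite [RHS]exchange_big; apply: eq_bigr => j _ /=.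
  apply: eq_bigr => k _.
  by rewrite (_ : (k + i + j = i + j + k)%N) //; lia.
rewrite (_ : \sum_(i < _) \sum_(j < _)
             \sum_(k < _ | _) lie (w i) (lie (u j) (v k)) =
  \sum_(i < n.+1) \sum_(j < n.+1) \sum_(k < n.+1 | (i + j + k == n)%N)
     lie (w k) (lie (u i) (v j))); last first.
  under [LHS]eq_bigr do under eq_bigr do rewrite big_mkcond.
  under [RHS]eq_bigr do under eq_bigr do rewrite big_mkcond.
  rewrite [LHS]exchange_big; apply: eq_bigr => i _ /=.
  rewrite [LHS]exchange_big; apply: eq_bigr => j _ /=.
  apply: eq_bigr => k _.
  by rewrite (_ : (k + i + j = i + j + k)%N) //; lia.
rewrite -!big_split big1 // => i _; rewrite -!big_split big1 // => j _.
by rewrite -!big_split big1 // => k _; apply: lie_jacobi.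
Qed.

HB.instance Definition _ := isLieAlgebra.Build K current
  clieDl clieDr clieZl clieZr cliexx clie_jacobi.

Lemma tens_sup (x : g) (f : {poly K}) : (fun n => f`_n *: x) \in finsupp.
Proof.
apply/finsuppP; exists (size f) => n hn.
by rewrite nth_default // scale0r.
Qed.

Definition tens (x : g) (f : {poly K}) : current := Current (tens_sup x f).

End Current.

Notation "x ⊗ f" := (tens x f) (at level 35, right associativity) : ring_scope.
Notation "x ⊗t^ p" := (tens x 'X^p)
  (at level 35, p at level 2, right associativity) : ring_scope.

(* Gradings.  A g[t]-module generated by an element w placed in grade 0 has
   only one possible grading, whose k-th piece is spanned by the elements
   (x_1 (x) t^p_1) ... (x_m (x) t^p_m) w with p_1 + ... + p_m = k.          *)

Section Grading.
Variables (K : numFieldType) (g : lieAlgType K).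
Local Notation L := (current g).

Definition is_grading (M : lieModType L) (G : nat -> set M) : Prop :=
  [/\ forall k, G k 0 /\ (forall a u v, G k u -> G k v -> G k (a *: u + v)),
      forall k p x v, G k v -> G (p + k)%N (act (x ⊗t^ p) v),
      forall v, exists n (c : nat -> M),
        (forall k, G k (c k)) /\ v = \sum_(k < n) c k
    & forall n (c : nat -> M), (forall k, G k (c k)) ->
        \sum_(k < n) c k = 0 -> forall k, (k < n)%N -> c k = 0].

Inductive grade (M : lieModType L) (w : M) : nat -> set M :=
| grade_gen : grade w 0 w
| grade0 k : grade w k 0
| gradeD k u v : grade w k u -> grade w k v -> grade w k (u + v)
| gradeZ k a v : grade w k v -> grade w k (a *: v)
| grade_act k p x v : grade w k v -> grade w (p + k) (act (x ⊗t^ p) v).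

(* The automorphism t |-> 2 t of g[t] acts by 2 ^+ k on the k-th piece, which
   makes the sum of the pieces direct.                                      *)
Fact twist_sup (f : L) : (fun n => 2 ^+ n *: f n) \in @finsupp K g.
Proof.
have /finsuppP[N hN] := cfunP f; apply/finsuppP; exists N => n hn.
by rewrite hN // scaler0.
Qed.
Definition twist (f : L) : L := Current (twist_sup f).

Lemma twistD f h : twist (f + h) = twist f + twist h.
Proof. by apply: current_eq => n; rewrite [RHS]cfunD -scalerDr -cfunD. Qed.
Lemma twistZ a f : twist (a *: f) = a *: twist f.
Proof.
by apply: current_eq => n; rewrite [RHS]cfunZ scalerA mulrC -scalerA -cfunZ.
Qed.
Lemma twist_lie f h : twist (lie f h) = lie (twist f) (twist h).
Proof.
apply: current_eq => n; rewrite /= /clie_fun scaler_sumr.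
apply: eq_bigr => i _ /=; rewrite lieZl lieZr scalerA -exprD.
by congr (_ ^+ _ *: _); have := ltn_ord i; lia.
Qed.
Lemma twist_tens x (f : {poly K}) : twist (x ⊗ f) = x ⊗ (f \Po (2 *: 'X)).
Proof.
apply: current_eq => n /=; rewrite scalerA; congr (_ *: _).
elim/poly_ind: f n => [|f c IH] n.
  by rewrite comp_poly0 !coef0 mulr0.
rewrite comp_polyD comp_polyM comp_polyX comp_polyC !coefD !coefC.
rewrite -scalerAr coefZ !coefMX.
case: n => [|n] /=; first by rewrite mulr0 !add0r expr0 mul1r.
by rewrite !addr0 -IH exprS mulrA.
Qed.
Lemma twist_mono x p : twist (x ⊗t^ p) = 2 ^+ p *: (x ⊗t^ p).
Proof.
apply: current_eq => n; rewrite cfunZ /= coefXn.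
by case: eqP => [->|] //=; rewrite !scale0r !scaler0.
Qed.

Lemma tens_decomp (f : L) : exists n, f = \sum_(p < n) f p ⊗t^ p.
Proof.
have /finsuppP[N hN] := cfunP f; exists N; apply: current_eq => n.
have sumE m (F : 'I_m -> L) : (\sum_(p < m) F p) n = \sum_(p < m) F p n.
  by apply: (big_morph (fun h : L => h n)) => [u v|]; [exact: cfunD|exact: cfun0].
rewrite sumE /=; have [h|h] := leqP N n.
  rewrite hN // big1 // => p _; rewrite coefXn.
  by rewrite (_ : (n == p) = false) ?scale0r //; have := ltn_ord p; lia.
rewrite (bigD1 (Ordinal h)) //= coefXn eqxx scale1r big1 ?addr0 // => p.
by rewrite -val_eqE /= coefXn eq_sym => /negPf->; rewrite scale0r.
Qed.

Definition gsum (M : lieModType L) (w v : M) : Prop :=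
  exists n (c : nat -> M), (forall k, grade w k (c k)) /\ v = \sum_(k < n) c k.

Definition twistable (M : lieModType L) (w : M) : Prop :=
  (forall v, gsum w v) /\
  exists phi : M -> M, [/\ linear phi, phi w = w
    & forall x v, phi (act x v) = act (twist x) (phi v)].

Lemma gsum_grade (M : lieModType L) (w : M) k v : grade w k v -> gsum w v.
Proof.
move=> h; exists k.+1, (fun i => if i == k then v else 0); split.
  by move=> i; case: eqP => [->|_] //; exact: grade0.
rewrite (bigD1 ord_max) //= eqxx big1 ?addr0 // => i.
by rewrite -val_eqE /= => /negPf ->.
Qed.

Lemma gsum_widen (M : lieModType L) (w : M) n N (c : nat -> M) :
  (n <= N)%N -> (forall k, grade w k (c k)) ->
  exists2 d : nat -> M, (forall k, grade w k (d k))
    & \sum_(k < n) c k = \sum_(k < N) d k.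
Proof.
move=> h hc; exists (fun k => if (k < n)%N then c k else 0).
  by move=> k; case: ifP => // _; exact: grade0.
by rewrite (big_ord_widen N c) // big_mkcond.
Qed.

Lemma gsumD (M : lieModType L) (w u v : M) :
  gsum w u -> gsum w v -> gsum w (u + v).
Proof.
move=> [n [c [hc ->]]] [m [d [hd ->]]].
have [c' hc' ->] := gsum_widen (leq_maxl n m) hc.
have [d' hd' ->] := gsum_widen (leq_maxr n m) hd.
exists (maxn n m), (fun k => c' k + d' k); split; last by rewrite big_split.
by move=> k; apply: gradeD.
Qed.

Lemma gsumZ (M : lieModType L) (w : M) a v : gsum w v -> gsum w (a *: v).
Proof.
move=> [n [c [hc ->]]]; exists n, (fun k => a *: c k); split.
  by move=> k; apply: gradeZ.
by rewrite scaler_sumr.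
Qed.

Lemma gsum_sum (M : lieModType L) (w : M) n (F : 'I_n -> M) :
  (forall i, gsum w (F i)) -> gsum w (\sum_i F i).
Proof.
move=> h; elim/big_ind: _ => //; first exact: gsum_grade (grade0 w 0).
exact: gsumD.
Qed.

Lemma act_suml (M : lieModType L) n (F : 'I_n -> L) (v : M) :
  act (\sum_i F i) v = \sum_i act (F i) v.
Proof.
have a0 : act (0 : L) v = 0 by have := actZl 0 0 v; rewrite !scale0r.
exact: (big_morph (fun x : L => act x v) (fun a b => actDl a b v) a0).
Qed.

Lemma act_sumr (M : lieModType L) n (x : L) (F : 'I_n -> M) :
  act x (\sum_i F i) = \sum_i act x (F i).
Proof.
have a0 : act x (0 : M) = 0 by have := actZr 0 x (0 : M); rewrite !scale0r.
exact: (big_morph (act x) (fun a b => actDr x a b) a0).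
Qed.

Lemma gsum_act (M : lieModType L) (w : M) x v : gsum w v -> gsum w (act x v).
Proof.
move=> [n [c [hc ->]]]; rewrite act_sumr; apply: gsum_sum => k.
have [m ->] := tens_decomp x; rewrite act_suml; apply: gsum_sum => p.
exact/(@gsum_grade _ _ (p + k))/grade_act.
Qed.

Lemma twistable_grading (M : lieModType L) (w : M) :
  twistable w -> is_grading (grade w).
Proof.
move=> [hs [phi [phil phiw phia]]]; split=> //.
- by move=> k; split=> [|a u v hu hv]; [exact: grade0 | exact/gradeD/hv/gradeZ].
- by move=> k p x v; apply: grade_act.
have phi0 : phi 0 = 0.
  by have := phil (-1) 0 0; rewrite scaler0 add0r scaleN1r addNr.
have phiD u v : phi (u + v) = phi u + phi v.
  by have := phil 1 u v; rewrite !scale1r.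
have phiZ a u : phi (a *: u) = a *: phi u.
  by have := phil a u 0; rewrite phi0 !addr0.
have phiE k v : grade w k v -> phi v = 2 ^+ k *: v.
  elim=> {k v} [|k|k u v _ eu _ ev|k a v _ e|k p x v _ e].
  - by rewrite phiw scale1r.
  - by rewrite phi0 scaler0.
  - by rewrite phiD eu ev scalerDr.
  - by rewrite phiZ e !scalerA mulrC.
  - by rewrite phia e twist_mono actZl actZr scalerA exprD.
elim=> [|n IH] c hc //; rewrite big_ord_recr /= => e.
have e1 : \sum_(k < n) (2 ^+ k - 2 ^+ n) *: c k = 0.
  have eA : \sum_(k < n) c k = - c n by apply/eqP; rewrite -addr_eq0 e.
  have eB : \sum_(k < n) 2 ^+ k *: c k = - (2 ^+ n *: c n).
    rewrite -(phiE _ _ (hc n)); apply/eqP; rewrite -addr_eq0; apply/eqP.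
    rewrite -[RHS]phi0 -[in RHS]e phiD (big_morph phi phiD phi0); congr (_ + _).
    by apply: eq_bigr => k _; rewrite (phiE _ _ (hc k)).
  under eq_bigr do rewrite scalerBl.
  by rewrite sumrB eB -scaler_sumr eA scalerN subrr.
have z k : (k < n)%N -> c k = 0.
  move=> hk; have := IH _ (fun k => gradeZ (2 ^+ k - 2 ^+ n) (hc k)) e1 k hk.
  move/eqP; rewrite scaler_eq0 subr_eq0.
  have -> : (2 ^+ k == 2 ^+ n :> K) = false; last by move/eqP.
  apply/negP; rewrite -!natrX eqr_nat eqn_exp2l // => /eqP ekn.
  by rewrite ekn ltnn in hk.
move=> k; rewrite ltnS leq_eqVlt => /predU1P[->|]; last exact: z.
by rewrite big1 ?add0r // in e => i _; apply: z.
Qed.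

Fixpoint tterm (a : mterm L) : mterm L :=
  match a with
  | TGen => TGen L
  | TZero => TZero L
  | TAdd a b => TAdd (tterm a) (tterm b)
  | TScale c a => TScale c (tterm a)
  | TAct x a => TAct (twist x) (tterm a)
  end.

Lemma meq_tterm a b : meq a b -> meq (tterm a) (tterm b).
Proof.
elim=> {a b} /= [u|u v _|u v w _ h1 _|u u' v v' _ h1 _|c u u' _|x u u' _
  |u v w|u v|u|u|c d u|u|c u v|c d u|x y u|x u v|c x u|c x u|x y u];
  rewrite ?twistD ?twistZ ?twist_lie.
- exact: meq_refl.
- exact: meq_sym.
- exact: meq_trans.
- exact: meq_add.
- exact: meq_scale.
- exact: meq_act.
- exact: meq_addA.
- exact: meq_addC.
- exact: meq_add0.
- exact: meq_addN.
- exact: meq_scaleA.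
- exact: meq_scale1.
- exact: meq_scaleDr.
- exact: meq_scaleDl.
- exact: meq_actDl.
- exact: meq_actDr.
- exact: meq_actZl.
- exact: meq_actZr.
- exact: meq_act_lie.
Qed.

Lemma free_twistable : twistable (free_gen : free_mod L).
Proof.
split=> [v|].
  have [a ->] := tcls_surj v; elim: a => [||a ea b eb|c a e|x a e].
  - exact/gsum_grade/grade_gen.
  - exact: gsum_grade (grade0 _ 0).
  - by rewrite tclsD; apply: gsumD.
  - by rewrite tclsZ; apply: gsumZ.
  - by rewrite tclsA; apply: gsum_act.
pose phi (v : free_mod L) : free_mod L := tcls (tterm (repr v)).
have phiE a : phi (tcls a) = tcls (tterm a).
  by apply/tclsP/meq_tterm/repr_tcls.
exists phi; split=> [c u v||x u].
- have [a ->] := tcls_surj u; have [b ->] := tcls_surj v.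
  by rewrite -tclsZ -tclsD !phiE /= tclsD tclsZ.
- exact: phiE.
- by have [a ->] := tcls_surj u; rewrite -tclsA !phiE /= tclsA.
Qed.

Lemma quot_twistable (M : lieModType L) (w : M) (S : set M) :
  twistable w ->
  (forall phi : M -> M, linear phi -> phi w = w ->
     (forall x v, phi (act x v) = act (twist x) (phi v)) ->
     forall v, S v -> gen_submod S (phi v)) ->
  twistable (proj_mod S w).
Proof.
move=> [hs [phi [phil phiw phia]]] hS; split.
  move=> v; have [u ->] := proj_mod_surj v; have [n [c [hc ->]]] := hs u.
  rewrite (big_morph (proj_mod S) (@proj_modD _ _ _ S) (erefl _)).
  exists n, (fun k => proj_mod S (c k)); split=> // k.
  elim: (hc k) => {k} [|k|k a b _ ea _ eb|k a b _ e|k p x b _ e].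
  - exact: grade_gen.
  - exact: grade0.
  - by rewrite proj_modD; apply: gradeD.
  - by rewrite proj_modZ; apply: gradeZ.
  - by rewrite proj_mod_act; apply: grade_act.
have phi0 : phi 0 = 0.
  by have := phil (-1) 0 0; rewrite scaler0 add0r scaleN1r addNr.
have phiD u v : phi (u + v) = phi u + phi v.
  by have := phil 1 u v; rewrite !scale1r.
have phiZ a u : phi (a *: u) = a *: phi u.
  by have := phil a u 0; rewrite phi0 !addr0.
have phiS v : gen_submod S v -> gen_submod S (phi v).
  elim=> {v} [v hv||u v _ hu _ hv|a v _ hv|x v _ hv].
  - exact: hS.
  - by rewrite phi0; constructor.
  - by rewrite phiD; apply: gen_submodD.
  - by rewrite phiZ; apply: gen_submodZ.
  - by rewrite phia; apply: gen_submod_act.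
pose psi (v : quot_mod S) : quot_mod S := proj_mod S (phi (repr v)).
have psiE u : psi (proj_mod S u) = proj_mod S (phi u).
  apply/proj_modP; rewrite -scaleN1r -phiZ -phiD scaleN1r.
  exact/phiS/repr_modP.
exists psi; split=> [c u v||x u].
- have [a ->] := proj_mod_surj u; have [b ->] := proj_mod_surj v.
  by rewrite -proj_modZ -proj_modD !psiE phil proj_modD proj_modZ.
- by rewrite psiE phiw.
- have [a ->] := proj_mod_surj u.
  by rewrite -proj_mod_act !psiE phia proj_mod_act.
Qed.

Lemma iter_actZ (M : lieModType L) (x : L) n c (v : M) :
  iter n (act x) (c *: v) = c *: iter n (act x) v.
Proof. by elim: n => //= n ->; rewrite actZr. Qed.

Lemma twist_iter (M : lieModType L) (phi : M -> M) x p n v :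
  linear phi -> (forall x v, phi (act x v) = act (twist x) (phi v)) ->
  phi (iter n (act (x ⊗t^ p)) v)
  = 2 ^+ (p * n) *: iter n (act (x ⊗t^ p)) (phi v).
Proof.
move=> phil phia; elim: n => [|n IH] /=; first by rewrite muln0 scale1r.
by rewrite phia IH twist_mono actZl actZr scalerA -exprD mulnS.
Qed.

(* Isomorphisms, of degree zero, of the g[t]-modules M and N graded by G, G' *)
Definition graded_iso (M N : lieModType L) (G : nat -> set M) (G' : nat -> set N)
    (f : M -> N) : Prop :=
  [/\ lie_hom f, bijective f & forall k v, G k v <-> G' k (f v)].

End Grading.

Section RootSystem.
Variable R : realType.
Local Notation C := R[i].
Variable g : fdLieAlgType C.

Definition lie_ideal (U : {vspace g}) : Prop :=
  forall x y, y \in U -> lie x y \in U.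

Definition simple_lie : Prop :=
  (exists x y : g, lie x y != 0) /\
  (forall U, lie_ideal U -> U = 0%VS \/ U = fullv).

Definition ad_semisimple (x : g) : Prop :=
  exists2 b : seq g, basis_of fullv b &
    forall v, v \in b -> exists c : C, lie x v = c *: v.

(* A toral subalgebra equal to its own centralizer: the usual notion of Cartan
   subalgebra when g is semisimple.                                         *)
Definition cartan_subalgebra (H : {vspace g}) : Prop :=
  [/\ forall x y, x \in H -> y \in H -> lie x y = 0,
      forall x, x \in H -> ad_semisimple x
    & forall x, (forall y, y \in H -> lie y x = 0) -> x \in H].

Definition dual (H : {vspace g}) := 'Hom(subvs_of H, C^o).

Variable H : {vspace g}.

Definition in_root_space (a : dual H) (x : g) : Prop :=
  forall h : subvs_of H, lie (vsval h) x = (a h : C) *: x.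

Definition root (a : dual H) : Prop :=
  a != 0 /\ exists2 x, x != 0 & in_root_space a x.

Definition nat_comb n (s : 'I_n -> dual H) (a : dual H) : Prop :=
  exists c : 'I_n -> nat, a = \sum_i (c i)%:R *: s i.

Definition root_base n (s : 'I_n -> dual H) : Prop :=
  [/\ forall i, root (s i),
      basis_of fullv [seq s i | i : 'I_n]
    & forall a, root a -> nat_comb s a \/ nat_comb s (- a)].

Definition pos_root n (s : 'I_n -> dual H) (a : dual H) : Prop :=
  root a /\ nat_comb s a.

Definition killing (x y : g) : C :=
  let b := vbasis (fullv : {vspace g}) in
  \sum_i coord b i (lie x (lie y b`_i)).

(* The element t_a of H that represents a through the Killing form, which is
   nondegenerate on H when g is simple and H is a Cartan subalgebra.         *)
Definition kdual (a : dual H) : subvs_of H :=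
  xget 0 [set t | forall h : subvs_of H, killing (vsval t) (vsval h) = a h].

Definition kform (a b : dual H) : C :=
  killing (vsval (kdual a)) (vsval (kdual b)).

(* The largest value of kform a a over the roots a, i.e. its value on the long
   roots; dividing by it gives these square length 2 for nform.              *)
Definition long_sq : C :=
  xget 0 [set c | (exists2 a, root a & c = kform a a) /\
                  forall b, root b -> kform b b <= c].

Definition nform (a b : dual H) : C := 2 / long_sq * kform a b.

Definition coroot (a : dual H) : subvs_of H := (2 / kform a a) *: kdual a.

(* The natural number equal to z; only meaningful when there is one, as is the
   case for 2 / (a, a) and for lam(h_a) with lam dominant integral.          *)
Definition natC (z : C) : nat := Num.truncn (complex.Re z).

Definition dcoef (a : dual H) : nat := natC (2 / nform a a).

End RootSystem.

(* A Cartan subalgebra, a base of the roots, and root vectors x_a^+, x_a^-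
   (relevant only for positive roots a).                                    *)
Record root_data (R : realType) (g : fdLieAlgType R[i]) := RootData {
  csa : {vspace g};
  csaP : cartan_subalgebra csa;
  rank : nat;
  simple_root : 'I_rank -> dual csa;
  simple_rootP : root_base simple_root;
  xp : dual csa -> g;
  xm : dual csa -> g;
  xpP : forall a, pos_root simple_root a ->
    [/\ xp a != 0, in_root_space a (xp a)
      & lie (vsval (coroot a)) (xp a) = 2 *: xp a];
  xmP : forall a, pos_root simple_root a ->
    [/\ xm a != 0, in_root_space (- a) (xm a)
      & lie (vsval (coroot a)) (xm a) = - (2 *: xm a)];
  xpmP : forall a, pos_root simple_root a ->
    lie (xp a) (xm a) = vsval (coroot a) }.
Arguments xp {R g} X a : rename.
Arguments xm {R g} X a : rename.

Section Modules.
Variables (R : realType) (g : fdLieAlgType R[i]) (X : root_data g).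
Local Notation C := R[i].
Local Notation H := (csa X).
Local Notation Rp := (pos_root (@simple_root _ _ X)).
Local Notation alpha := (@simple_root _ _ X).

Definition cow (a : dual H) : g := vsval (coroot a).

Definition dominant (lam : dual H) : Prop :=
  forall i, exists k : nat, lam (coroot (alpha i)) = k%:R.

Definition pairing (lam a : dual H) : nat := natC (lam (coroot a)).

Variable lam : dual H.

Let F := free_mod (current g).
Let u : F := free_gen.

(* wloc is the module with generator w and the defining relations v = 0, v in
   wloc_rel: the free module on u modulo the submodule generated by wloc_rel. *)
Definition wloc_rel : set F :=
  [set v | exists i (f : {poly C}), v = act (xp X (alpha i) ⊗ f) u] `|`
  [set v | exists i (s : nat),
     v = act (cow (alpha i) ⊗t^ s) u
         - ((lam (coroot (alpha i)) : C) * (s == 0%N)%:R) *: u] `|`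
  [set v | exists i,
     v = iter (pairing lam (alpha i)).+1 (act (xm X (alpha i) ⊗ 1)) u].

Definition wloc := quot_mod wloc_rel.
Definition wgen : wloc := proj_mod wloc_rel u.

(* xi is a family of partitions xi^a of lam(h_a), a a positive root, with
   xi a = [:: xi^a_1; xi^a_2; ...] up to trailing zeros, so that
   sumn (drop k (xi a)) is \sum_(j >= k+1) xi^a_j.                           *)
Definition V_rel (xi : dual H -> seq nat) : set wloc :=
  [set v | exists a s r k,
     [/\ Rp a, (0 < s)%N, (0 < r)%N, (0 < k)%N
      & (1 + r * k + sumn (drop k (xi a)) <= s + r)%N] /\
     v = iter s (act (xp X a ⊗ 'X)) (iter (s + r) (act (xm X a ⊗ 1)) wgen)].

Definition Vmod (xi : dual H -> seq nat) := quot_mod (V_rel xi).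
Definition Vgen (xi : dual H -> seq nat) : Vmod xi := proj_mod (V_rel xi) wgen.

Variable l : nat.

Definition s_of (a : dual H) : nat :=
  if pairing lam a == 0%N then 0%N
  else ((pairing lam a).-1 %/ (dcoef a * l)).+1.
Definition m_of (a : dual H) : nat :=
  if pairing lam a == 0%N then 0%N
  else ((pairing lam a).-1 %% (dcoef a * l)).+1.

Lemma s_m_unique a : (0 < dcoef a * l)%N -> (0 < pairing lam a)%N ->
  forall s m : nat,
  [/\ (0 < s)%N, pairing lam a = ((s - 1) * (dcoef a * l) + m)%N
    & (0 < m <= dcoef a * l)%N] <-> s = s_of a /\ m = m_of a.
Proof.
rewrite /s_of /m_of; set N := pairing lam a; set D := (_ * _)%N => D0 N0 s m.
rewrite eqn0Ngt N0 /=; split=> [[s0 eN /andP[m0 mD]]|[-> ->]].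
  have -> : N.-1 = ((s - 1) * D + m.-1)%N by lia.
  have m1 : (m.-1 < D)%N by lia.
  by rewrite divnMDl // modnMDl divn_small // modn_small //; lia.
have := divn_eq N.-1 D; have := ltn_pmod N.-1 D0.
by set q := (_ %/ _)%N; set r := (_ %% _)%N => h1 h2; split; lia.
Qed.

Definition xi_of (a : dual H) : seq nat :=
  if pairing lam a == 0%N then [::]
  else rcons (nseq (s_of a - 1) (dcoef a * l)) (m_of a).

(* The difference is truncated at 0. *)
Definition D_rel : set wloc :=
  [set v | exists a p r, [/\ Rp a,
     (maxn 0 (pairing lam a - dcoef a * l * p) <= r)%N
     & v = iter r.+1 (act (xm X a ⊗t^ p)) wgen]].

Definition Dmod := quot_mod D_rel.
Definition Dgen : Dmod := proj_mod D_rel wgen.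

Definition Dmin_rel : set wloc :=
  [set v | exists2 a, Rp a & v = act (xm X a ⊗t^ (s_of a)) wgen] `|`
  [set v | exists a, [/\ Rp a, (0 < pairing lam a)%N, (m_of a < dcoef a * l)%N
     & v = iter (m_of a).+1 (act (xm X a ⊗t^ (s_of a - 1))) wgen]].

Lemma wloc_twistable : twistable wgen.
Proof.
apply: quot_twistable; first exact: free_twistable.
move=> phi phil phiw phia v; set S := wloc_rel.
have phiD c a b : phi (c *: a + b) = c *: phi a + phi b by exact: phil.
case=> [ [ [i [f ->] ] | [i [s ->] ] ] | [i ->] ].
- rewrite phia phiw twist_tens.
  by apply: gen_submod_in; left; left; exists i, (f \Po (2 *: 'X)).
- rewrite addrC -scaleNr phiD phia phiw twist_mono actZl.
  rewrite [X in gen_submod _ X](_ : _ = 2 ^+ s *: (act (cow (alpha i) ⊗t^ s) u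
         - ((lam (coroot (alpha i)) : C) * (s == 0%N)%:R) *: u)).
    by apply/gen_submodZ/gen_submod_in; left; right; exists i, s.
  rewrite scalerBr scalerA addrC scaleNr; congr (_ - _ *: _).
  by case: s => [|s]; rewrite ?mul1r // !mulr0.
- rewrite -[_ ⊗ 1]/(_ ⊗t^ 0) (twist_iter _ _ _ _ phil phia) phiw.
  by apply/gen_submodZ/gen_submod_in; right; exists i.
Qed.

Lemma wloc_grading : is_grading (grade wgen).
Proof. exact/twistable_grading/wloc_twistable. Qed.

Lemma Vmod_grading xi : is_grading (grade (Vgen xi)).
Proof.
apply: twistable_grading; apply: quot_twistable; first exact: wloc_twistable.
move=> phi phil phiw phia v [a [s [r [k [h ->]]]]].
rewrite -[_ ⊗ 1]/(_ ⊗t^ 0) -[_ ⊗ 'X]/(_ ⊗t^ 1).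
rewrite (twist_iter _ _ _ _ phil phia) (twist_iter _ _ _ _ phil phia) phiw iter_actZ.
by apply/gen_submodZ/gen_submodZ/gen_submod_in; exists a, s, r, k.
Qed.

Lemma Dmod_grading : is_grading (grade Dgen).
Proof.
apply: twistable_grading; apply: quot_twistable; first exact: wloc_twistable.
move=> phi phil phiw phia v [a [p [r [ha hr ->]]]].
rewrite (twist_iter _ _ _ _ phil phia) phiw.
by apply/gen_submodZ/gen_submod_in; exists a, p, r.
Qed.

End Modules.

Arguments V_rel {R g X} lam xi _.
Arguments D_rel {R g X} lam l _.
Arguments Dmin_rel {R g X} lam l _.

(* Main.v *)
Require Import Defs.
From HB Require Import structures.
From mathcomp Require Import all_boot all_order all_algebra.
From mathcomp Require Import complex zify ring.
From mathcomp Require Import boolp classical_sets functions reals.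

Set Implicit Arguments.
Unset Strict Implicit.
Unset Printing Implicit Defensive.

Import Order.TTheory GRing.Theory Num.Theory.
Local Open Scope classical_set_scope.
Local Open Scope ring_scope.

(* Fix a positive root a and write f_p = x_a^- t^p, f(z) = \sum_p f_p z^p,
   N = lambda(h_a), D = d_a l, N = (s - 1) D + m.  By Garland's formula the
   element (x_a^+ t)^q (x_a^-)^(q+r) w is a nonzero multiple of the coefficient of
   z^q in f(z)^r w, and this coefficient vanishes when q + r > N because
   (x_a^-)^(N+1) w = 0.

   If f_p w = 0 for p >= s and f_(s-1)^(m+1) w = 0, then a defining relation of
   V(xi) with r <= D holds because no monomial in the coefficient survives, and one
   with r > D because then q + r > N.  Conversely, the relations of V(xi) for a
   given k say that the coefficients of f(z)^r w vanish beyond a bound; this bound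
   is inherited when the modes p < k are removed from f(z) one at a time, and then the
   lowest coefficient f_k^r w vanishes for r > \sum_(j > k) xi_j.

   This needs (x_a^-)^(N+1) w = 0 for all positive a, simple or not.  Each x_i^- is
   locally nilpotent, hence every weight lambda - gamma of the module generated by w
   has (lambda, lambda) >= (lambda - gamma, lambda - gamma), by reflection to the
   dominant chamber; this fails for gamma = k a with k large.  That the form is
   positive on roots comes from 4 / (a, a) = tr((ad h_a)^2), a sum of squares of
   integers, and that the x_i^+ generate all positive root vectors from the
   nondegeneracy of the Killing form. *)

(** * Elementary identities in Lie algebra modules *)

Section ModuleTheory.
Variables (K : fieldType) (L : lieAlgType K) (M : lieModType L).
Implicit Types (x y : L) (u v : M).

Lemma act0l v : act (0 : L) v = 0.
Proof. by have := actZl 0 (0 : L) v; rewrite !scale0r. Qed.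

Lemma act0r x : act x (0 : M) = 0.
Proof. by have := actZr 0 x (0 : M); rewrite !scale0r. Qed.

Lemma actNl x v : act (- x) v = - act x v.
Proof. by rewrite -scaleN1r actZl scaleN1r. Qed.

Lemma act_sum I (r : seq I) P (F : I -> M) x :
  act x (\sum_(i <- r | P i) F i) = \sum_(i <- r | P i) act x (F i).
Proof. exact: (big_morph (act x) (actDr x) (act0r x)). Qed.

Lemma act_sum_l I (r : seq I) P (F : I -> L) v :
  act (\sum_(i <- r | P i) F i) v = \sum_(i <- r | P i) act (F i) v.
Proof. exact: (big_morph (act^~ v) (fun x y => actDl x y v) (act0l v)). Qed.

Lemma actC x y v : act x (act y v) = act (lie x y) v + act y (act x v).
Proof. by rewrite act_lie subrK. Qed.

Lemma iter_act0 x n : iter n (act x) (0 : M) = 0.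
Proof. by elim: n => //= n ->; rewrite act0r. Qed.

Lemma iter_actD x n u v :
  iter n (act x) (u + v) = iter n (act x) u + iter n (act x) v.
Proof. by elim: n => //= n ->; rewrite actDr. Qed.

Lemma iter_act_scale x n c v :
  iter n (act x) (c *: v) = c *: iter n (act x) v.
Proof. by elim: n => //= n ->; rewrite actZr. Qed.

Lemma iter_act_ge x n k v : (n <= k)%N ->
  iter n (act x) v = 0 -> iter k (act x) v = 0.
Proof. by move=> /subnK <- h; rewrite iterD h iter_act0. Qed.

Lemma iter_act_mul x y c n v : lie x y = c *: y ->
  forall a, act x v = a *: v ->
  act x (iter n (act y) v) = (a + n%:R * c) *: iter n (act y) v.
Proof.
move=> hxy a hv; elim: n => [|n IH] /=; first by rewrite mul0r addr0.
by rewrite actC hxy IH actZl actZr -scalerDl mulrSr; congr (_ *: _); ring.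
Qed.

End ModuleTheory.

Section Adjoint.
Variables (K : fieldType) (L : lieAlgType K).

(** A copy of L seen as a module over itself, so that lemmas on iterated actions apply to iterated
    brackets. *)
Definition adjoint : Type := L.
HB.instance Definition _ := GRing.Lmodule.on adjoint.

Fact adjoint_act_lie (x y : L) (v : adjoint) :
  lie (lie x y) v = lie x (lie y v) - lie y (lie x v) :> L.
Proof.
have := lie_jacobi x y v.
rewrite (lieC v x) liexN (lieC v) => /eqP; rewrite subr_eq0 => /eqP ->.
by [].
Qed.
HB.instance Definition _ := isLieModule.Build K L adjoint
  (@lieDl K L) (@lieDr K L) (@lieZl K L) (@lieZr K L) adjoint_act_lie.

End Adjoint.

(** * Highest weight vectors for sl_2 *)

Section Sl2.
Variables (K : numFieldType) (L : lieAlgType K) (M : lieModType L).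
Variables (e h f : L).
Hypotheses (hef : lie e f = h) (hhe : lie h e = 2 *: e) (hhf : lie h f = - (2 *: f)).
Implicit Types (v : M) (a : K) (n k q : nat).

(** Moving e through f^(n+1) releases one h at each place; the eigenvalues a, a - 2, ..., a - 2n sum
    to (n + 1)(a - n). *)
Lemma sl2_raise_lower n v a : act e v = 0 -> act h v = a *: v ->
  act e (iter n.+1 (act f) v) = (n.+1%:R * (a - n%:R)) *: iter n (act f) v.
Proof.
move=> hev hhv; elim: n => [|n IH].
  by rewrite /= actC hef hev act0r addr0 hhv mul1r subr0.
rewrite iterS actC hef IH actZr -iterS (iter_act_mul _ (c := -2) _ hhv) ?scaleNr //.
by rewrite -scalerDl; congr (_ *: _); rewrite !mulrSr; ring.
Qed.

Lemma sl2_lower_raise n v a : act h v = a *: v ->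
  act e (iter n (act e) (act f v)) =
  act f (iter n.+1 (act e) v) + (n.+1%:R * (a + n%:R)) *: iter n (act e) v.
Proof.
move=> hhv; elim: n => [|n IH].
  by rewrite /= actC hef hhv mul1r addr0 addrC.
rewrite iterS IH actDr actZr actC hef.
rewrite (iter_act_mul _ (c := 2) _ hhv) // -!iterS addrAC [LHS]addrC.
by congr (_ + _); rewrite -scalerDl; congr (_ *: _); rewrite !mulrSr; ring.
Qed.

(** Let n + 1 be the least power of f that kills v. Applying e gives (n + 1)(a - n) f^n v = 0 with
    f^n v nonzero, hence a = n. *)
Lemma sl2_highest_weight v a k :
  v != 0 -> act e v = 0 -> act h v = a *: v -> iter k (act f) v = 0 ->
  exists n, [/\ (n < k)%N, a = n%:R & iter n.+1 (act f) v = 0].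
Proof.
move=> v0 hev hhv hk.
have hex : exists k, iter k (act f) v == 0 by exists k; apply/eqP.
case: (ex_minnP hex) => -[|n] /eqP hn hmin; first by case/eqP: v0.
have nk : (n < k)%N by apply: hmin; apply/eqP.
exists n; split=> //; have := sl2_raise_lower n hev hhv.
rewrite hn act0r => /esym/eqP; rewrite scaler_eq0 mulf_eq0 pnatr_eq0 /= subr_eq0.
by case/orP=> [/eqP //|/hmin]; rewrite ltnn.
Qed.

End Sl2.

(** Induction on k: f v has weight -(q + 2) and e^(q+2) f v = 0, so f v = 0. Then v is a highest
    weight vector of weight q for the opposite triple (f, -h, e), and e^q v = 0 forces v = 0. *)
Lemma sl2_raise_inj (K : numFieldType) (L : lieAlgType K) (M : lieModType L)
    (e h f : L) q k (v : M) :
  lie e f = h -> lie h e = 2 *: e -> lie h f = - (2 *: f) ->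
  act h v = - q%:R *: v -> iter k (act f) v = 0 -> iter q (act e) v = 0 -> v = 0.
Proof.
move=> hef hhe hhf; elim: k q v => [|k IH] q v hv // hk hq.
have fv0 : act f v = 0.
  apply: (IH q.+2); last 1 first.
  - rewrite iterS (sl2_lower_raise hef hhe _ hv).
    have eq1 : iter q.+1 (act e) v = 0 by rewrite iterS hq act0r.
    by rewrite iterS eq1 scaler0 addr0 !act0r.
  - rewrite actC hhf hv actNl actZl actZr -scaleNr -scalerDl !mulrSr.
    by congr (_ *: _); ring.
  - by rewrite -iterSr.
apply/eqP/negPn/negP => v0.
have h1 : lie f e = - h by rewrite lieC hef.
have h2 : lie (- h) e = - (2 *: e) by rewrite lieNx hhe.
have h3 : act (- h) v = q%:R *: v by rewrite actNl hv scaleNr opprK.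
have [n [nq /eqP]] := sl2_highest_weight h1 h2 v0 fv0 h3 hq.
by rewrite eqr_nat => /eqP qn; rewrite qn ltnn in nq.
Qed.

(* A function [nat -> M] is read as a formal series in z with coefficients in
   M, on which a sequence [u] of elements of L acts by the series
   [\sum_p u_p z^p] of operators. *)
Section Series.
Variables (K : numFieldType) (L : lieAlgType K) (M : lieModType L).
Implicit Types (u v : nat -> L) (X Y : nat -> M) (a k n p r : nat).

Definition conv u X : nat -> M := fun a => \sum_(p < a.+1) act (u p) (X (a - p)%N).

Lemma convD u X Y : conv u (X + Y) = conv u X + conv u Y.
Proof.
apply/funext => a; rewrite !addrfctE /conv -big_split.
by apply: eq_bigr => p _; rewrite actDr.
Qed.

Lemma convZ u c X : conv u (c *: X) = c *: conv u X.
Proof.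
apply/funext => a; rewrite !scalrfctE /conv scaler_sumr.
by apply: eq_bigr => p _; rewrite actZr.
Qed.

Lemma conv0 u : conv u 0 = 0.
Proof. by rewrite -[0 in LHS](scale0r (0 : nat -> M)) convZ scale0r. Qed.

Lemma convB u X Y : conv u (X - Y) = conv u X - conv u Y.
Proof. by rewrite convD -scaleN1r convZ scaleN1r. Qed.

Lemma convZl c u X : conv (c *: u) X = c *: conv u X.
Proof.
apply/funext => a; rewrite !scalrfctE /conv scaler_sumr.
by apply: eq_bigr => p _; rewrite actZl.
Qed.

Lemma conv0l X : conv 0 X = 0.
Proof. by rewrite -[0 in LHS](scale0r (0 : nat -> L)) convZl scale0r. Qed.

Lemma convE u X B a : (a < B)%N ->
  conv u X a = \sum_(p < B | (p <= a)%N) act (u p) (X (a - p)%N).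
Proof.
by move=> aB; rewrite /conv (big_ord_widen B (fun p => act (u p) (X (a - p)%N))).
Qed.

Lemma conv2E u v X a : conv u (conv v X) a =
  \sum_(i < a.+1) \sum_(j < a.+1 | (i + j <= a)%N)
    act (u i) (act (v j) (X (a - i - j)%N)).
Proof.
apply: eq_bigr => i _; rewrite (@convE v X a.+1) ?ltnS ?leq_subr // act_sum.
by apply: eq_bigl => j; have := ltn_ord i; lia.
Qed.

Definition lie_conv u v : nat -> L := fun m => \sum_(i < m.+1) lie (u i) (v (m - i)%N).

(** The series form of x y = y x + [x, y]; the bracket term is reindexed from the total degree m = i
    + j to the pair (i, j). *)
Lemma conv_lie u v X :
  conv u (conv v X) = conv v (conv u X) + conv (lie_conv u v) X.
Proof.
apply/funext => a; rewrite addrfctE !conv2E.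
rewrite [X in _ = X + _](exchange_big_dep xpredT) //=.
have -> : conv (lie_conv u v) X a =
    \sum_(i < a.+1) \sum_(j < a.+1 | (i + j <= a)%N)
      act (lie (u i) (v j)) (X (a - i - j)%N).
  rewrite /conv; transitivity (\sum_(m < a.+1) \sum_(i < a.+1 | (i <= m)%N)
      act (lie (u i) (v (m - i)%N)) (X (a - m)%N)).
    apply: eq_bigr => m _; rewrite act_sum_l.
    by rewrite (big_ord_widen a.+1
      (fun i => act (lie (u i) (v (m - i)%N)) (X (a - m)%N))).
  rewrite (exchange_big_dep xpredT) //=; apply: eq_bigr => i _.
  rewrite -(big_mkord (fun m => (i <= m)%N)
    (fun m => act (lie (u i) (v (m - i)%N)) (X (a - m)%N))).
  rewrite -(big_mkord (fun j => (i + j <= a)%N)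
    (fun j => act (lie (u i) (v j)) (X (a - i - j)%N))).
  have ia : (i <= a.+1)%N by apply: ltnW.
  rewrite (@big_cat_nat _ _ _ i) //= big_nat_cond big1 ?add0r; last first.
    by move=> m; lia.
  rewrite -{1}[nat_of_ord i]add0n big_addn.
  rewrite [RHS](@big_cat_nat _ _ _ (a.+1 - i)%N) ?leq_subr //=.
  rewrite [X in _ = _ + X]big_nat_cond [X in _ = _ + X]big1 ?addr0; last first.
    by move=> m; lia.
  rewrite big_nat_cond [RHS]big_nat_cond; apply: eq_big => [m|m hm]; first by lia.
  by rewrite addnK -subnDA addnC.
rewrite /= -big_split; apply: eq_bigr => i _.
transitivity (\sum_(j < a.+1 | (i + j <= a)%N)
    (act (v j) (act (u i) (X (a - j - i)%N))
     + act (lie (u i) (v j)) (X (a - i - j)%N))).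
  by apply: eq_bigr => j _; rewrite actC addrC -!subnDA (addnC j).
by rewrite big_split; congr (_ + _); apply: eq_bigl => j; rewrite addnC.
Qed.

End Series.

(** * Garland's formula for sl_2[t] *)

Section Garland.
Variables (K : numFieldType) (L : lieAlgType K) (M : lieModType L).
Variables (f : nat -> L) (w : M).
Hypothesis ff : forall p q, lie (f p) (f q) = 0.
Implicit Types (X : nat -> M) (a k n p q r : nat).

Definition const_ser (v : M) : nat -> M := fun a => if a is 0 then v else 0.

(* The coefficient of index a is the sum of the [f_p1 ... f_pr w] over p1 + ... + pr = a,
   i.e. r! x^-(r, a) w in the notation of Garland's formula. *)
Definition pow_ser r : nat -> M := iter r (conv f) (const_ser w).

Lemma conv_scaled_comm X (u v : nat -> L) :
  (forall p, exists q (c : K), u p = c *: f q) ->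
  (forall p, exists q (c : K), v p = c *: f q) ->
  conv u (conv v X) = conv v (conv u X).
Proof.
move=> hu hv; rewrite conv_lie (_ : lie_conv u v = 0) ?conv0l ?addr0 //.
apply/funext => m; rewrite /lie_conv big1 // => i _.
have [q [a ->]] := hu i; have [q' [a' ->]] := hv (m - i)%N.
by rewrite lieZl lieZr ff !scaler0.
Qed.

(** The formal derivative d/dz; [der_coef] below is f'(z). *)
Definition der_ser X : nat -> M := fun a => a.+1%:R *: X a.+1.
Definition der_coef : nat -> L := fun p => p.+1%:R *: f p.+1.

(** The Leibniz rule: the factor a + 1 is split as (a + 1 - p) + p, one part differentiating X and
    the other f. *)
Lemma der_conv X : der_ser (conv f X) = conv f (der_ser X) + conv der_coef X.
Proof.
apply/funext => a; rewrite addrfctE /der_ser /conv scaler_sumr.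
transitivity (\sum_(p < a.+2) (act (f p) ((a.+1 - p)%:R *: X (a.+1 - p)%N)
                 + act (p%:R *: f p) (X (a.+1 - p)%N))).
  apply: eq_bigr => p _; rewrite actZr actZl -scalerDl -natrD subnK //.
  by rewrite -ltnS.
rewrite big_split; congr (_ + _) => /=.
  rewrite big_ord_recr /= subnn scale0r act0r addr0.
  by apply: eq_bigr => p _; rewrite subSn // -ltnS.
rewrite big_ord_recl /= scale0r act0l add0r.
by apply: eq_bigr => p _; rewrite /bump /= add1n subSS.
Qed.

Lemma conv_der_comm X : conv f (conv der_coef X) = conv der_coef (conv f X).
Proof.
apply: conv_scaled_comm => // p; first by exists p, 1; rewrite scale1r.
by exists p.+1, p.+1%:R.
Qed.

Lemma der_pow_ser r : der_ser (pow_ser r.+1) = r.+1%:R *: conv der_coef (pow_ser r).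
Proof.
elim: r => [|r IH]; rewrite /= der_conv.
  rewrite (_ : der_ser _ = 0) ?conv0 ?add0r ?scale1r //.
  by apply/funext => a; rewrite /der_ser scaler0.
by rewrite IH convZ conv_der_comm -/(pow_ser r.+1) [in RHS]mulrSr scalerDl scale1r.
Qed.

Lemma pow_ser0 r : pow_ser r 0 = iter r (act (f 0)) w.
Proof. by elim: r => //= r; rewrite /conv big_ord1 => ->. Qed.

Variables (e : L) (h : nat -> L).
Hypothesis ef : forall p, lie e (f p) = h p.+1.
Hypothesis hf : forall p q, lie (h p) (f q) = - (2 *: f (p + q)).
Hypothesis ew : act e w = 0.
Hypothesis hw : forall p, act (h p.+1) w = 0.

(** The coefficients of the series [e, f(z)]. *)
Let h1 p := h p.+1.

Lemma lie_conv_h1 : lie_conv h1 f = - 2 *: der_coef.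
Proof.
apply/funext => m; rewrite scalrfctE /lie_conv /der_coef.
transitivity (\sum_(i < m.+1) - (2 *: f m.+1)).
  by apply: eq_bigr => i _; rewrite hf addSn subnKC // -ltnS.
rewrite sumr_const card_ord -scaler_nat scaleNr scalerN scalerA; congr (- _).
by rewrite scalerA mulrC.
Qed.

(** As h1(z) kills w, only the commutators [h1(z), f(z)] = -2 f'(z) contribute, one for each factor
    f(z). *)
Lemma h1_pow_ser r :
  conv h1 (pow_ser r.+1) = - (2 * r.+1%:R) *: conv der_coef (pow_ser r).
Proof.
elim: r => [|r IH]; rewrite /= conv_lie lie_conv_h1 convZl.
  rewrite (_ : conv h1 _ = 0) ?conv0 ?add0r ?mulr1 //.
  apply/funext => a; apply: big1 => p _.
  by case: (a - p)%N => [|?] /=; rewrite ?hw ?act0r.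
rewrite IH convZ conv_der_comm -scalerDl -/(pow_ser r.+1).
by congr (_ *: _); rewrite !mulrSr; ring.
Qed.

Lemma act_conv X a :
  act e (conv f X a) = conv f (act e \o X) a + conv h1 X a.
Proof.
rewrite /conv act_sum -big_split; apply: eq_bigr => p _ /=.
by rewrite actC ef addrC.
Qed.

(** Moving E through the first factor gives E f^(r+1) w = f E f^r w + h1 f^r w; by induction both
    terms are multiples of f' f^(r-1) w. *)
Lemma act_pow_ser r a :
  act e (pow_ser r.+1 a) = - (r.+1 * a.+1)%:R *: pow_ser r a.+1.
Proof.
suff: act e \o pow_ser r.+1 = - r.+1%:R *: der_ser (pow_ser r).
  move/(congr1 (@^~ a)) => /= ->.
  by rewrite scalrfctE /der_ser scalerA natrM mulNr.
elim: r => [|r IH]; apply/funext => b.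
  rewrite [LHS]act_conv.
  rewrite /conv !big1 ?addr0 => [|p _|p _].
  - by rewrite scalrfctE /der_ser !scaler0.
  - by rewrite /pow_ser /=; case: (b - p)%N => [|?] /=; rewrite ?hw ?act0r.
  - by rewrite /pow_ser /=; case: (b - p)%N => [|?] /=; rewrite ?ew !act0r.
rewrite /comp [pow_ser r.+2]/(conv f (pow_ser r.+1)) act_conv.
rewrite IH h1_pow_ser der_pow_ser convZ.
have -> : conv f (der_ser (pow_ser r)) = r%:R *: conv der_coef (pow_ser r).
  case: r {IH} => [|r]; last by rewrite der_pow_ser convZ conv_der_comm.
  rewrite scale0r (_ : der_ser _ = 0) ?conv0 //.
  by apply/funext => c; rewrite /der_ser scaler0.
rewrite !scalrfctE !scalerA -scalerDl; congr (_ *: _); rewrite !mulrSr; ring.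
Qed.

(* Garland's formula modulo the annihilator of w: with E the action of e,
   E f(z)^r w = - r d/dz (f(z)^(r-1)) w. *)
Lemma garland k r a : exists2 c : K, c != 0 &
  iter k (act e) (pow_ser (k + r) a) = c *: pow_ser r (a + k).
Proof.
elim: k a => [|k IH] a; first by exists 1; rewrite ?oner_neq0 // scale1r addn0.
have [c c0 E] := IH a.+1.
exists (- ((k + r).+1 * a.+1)%:R * c).
  by rewrite mulf_neq0 // oppr_eq0 pnatr_eq0.
by rewrite iterSr addSn act_pow_ser iter_act_scale E scalerA addSnnS.
Qed.

(** The constant coefficient of f(z)^(k+r) w is f_0^(k+r) w, so the case a = 0 of [garland] turns
    the relations of V(xi) into vanishing coefficients of f(z)^r w. *)
Lemma garland_eq0 k r :
  iter k (act e) (iter (k + r) (act (f 0)) w) = 0 <-> pow_ser r k = 0.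
Proof.
rewrite -pow_ser0; have [c c0 ->] := garland k r 0.
by split=> [/eqP|->]; rewrite ?scaler0 // scaler_eq0 (negPf c0) => /eqP.
Qed.

End Garland.

(** * Vanishing of coefficients of f(z)^r v *)

Section PowSerVanishing.
Variables (K : numFieldType) (L : lieAlgType K) (M : lieModType L) (f : nat -> L).
Hypothesis ff : forall p q, lie (f p) (f q) = 0.
Implicit Types (v w : M) (X : nat -> M) (a k m n p q r s t : nat).

Lemma pow_ser_base0 r : pow_ser f (0 : M) r = 0.
Proof.
elim: r => [|r IH]; first by apply/funext => -[|a].
by rewrite /pow_ser /= -/(pow_ser _ _ r) IH conv0.
Qed.

Lemma act_pow_ser_base p v r a :
  act (f p) (pow_ser f v r a) = pow_ser f (act (f p) v) r a.
Proof.
elim: r a => [|r IH] [|a] //=; rewrite ?act0r //; rewrite /conv act_sum.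
  by apply: eq_bigr => q _; rewrite actC ff act0l add0r IH.
by apply: eq_bigr => q _; rewrite actC ff act0l add0r IH.
Qed.

(* No monomial [f_p1 ... f_pr v] survives when p1 + ... + pr is this large. *)
Lemma pow_ser_large t m v r a :
  (forall p, (t.+1 < p)%N -> act (f p) v = 0) -> iter m.+1 (act (f t.+1)) v = 0 ->
  (t * r + minn r m < a)%N -> pow_ser f v r a = 0.
Proof.
elim: r m v a => [|r IH] m v a hv hm ha; first by case: a ha => //; lia.
rewrite /pow_ser /= -/(pow_ser _ _ r) /conv big1 // => p _.
have [pt|pt|pt] := ltngtP p t.+1; last 1 first.
(* At most m factors may have index t + 1. This one is absorbed into v, which leaves m - 1; for m =
   0 it already kills v. *)
- rewrite pt act_pow_ser_base; case: m hm ha => [|m] hm ha.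
    by move: hm => /= ->; rewrite pow_ser_base0.
  apply: (IH m); last by lia.
    by move=> q hq; rewrite actC ff act0l hv // act0r addr0.
  by rewrite -iterSr.
- by rewrite (IH m) ?act0r //; lia.
- by rewrite act_pow_ser_base hv // pow_ser_base0.
Qed.

(** [Kk] stands for the sum of the parts of xi beyond the k-th. For r > D the bounds give a + r > N;
    for r <= D they put a above the degree of every surviving monomial. *)
Lemma pow_ser_eq0_of_top (D N s m : nat) v r k a (Kk : nat) :
  (0 < D)%N -> (0 < s)%N -> N = ((s - 1) * D + m)%N -> (0 < k)%N ->
  (forall p, (s <= p)%N -> act (f p) v = 0) ->
  ((m < D)%N -> iter m.+1 (act (f (s - 1)%N)) v = 0) -> (m <= D)%N ->
  (forall r a, (N < a + r)%N -> pow_ser f v r a = 0) ->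
  (N <= k * D + Kk)%N -> (1 + r * k + Kk <= a + r)%N -> pow_ser f v r a = 0.
Proof.
move=> D0 s0 eN k0 hs hm mD hN hK ha.
have [Dr|rD] := ltnP D r.
  by apply: hN; nia.
case: s s0 eN hs hm => // s _; rewrite subn1 /= => eN hs hm.
have hS : (s * r < a)%N -> pow_ser f v r a = 0.
  move=> hsr; apply: (@pow_ser_large s 0); last by rewrite minn0 addn0.
    by move=> p sp; apply: hs; lia.
  exact: hs.
have [sk|ks] := leqP s.+1 k; first by apply: hS; nia.
move: mD; rewrite leq_eqVlt => /orP[/eqP mD|mD]; first by apply: hS; nia.
case: s eN hs hm {hS} ks => [|s] eN hs hm ks; first by lia.
apply: (@pow_ser_large s m) => //; first exact: hm.
(* Splitting the multiples of s + 1 at k, and using r <= D, the bounds yield a >= 1 + (k - 1) r + (s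
   + 1 - k) r + m = 1 + s r + m. *)
have e1 : (k * r + (s.+1 - k) * r = s.+1 * r)%N by rewrite -mulnDl subnKC // -ltnS.
have e2 : (k * D + (s.+1 - k) * D = s.+1 * D)%N by rewrite -mulnDl subnKC // -ltnS.
have e3 : ((s.+1 - k) * r <= (s.+1 - k) * D)%N by rewrite leq_mul.
have := geq_minr r m; rewrite mulSn in e1.
lia.
Qed.

Definition ge_coef k : nat -> L := fun p => if (k <= p)%N then f p else 0.

(** The action of the single term f_k z^k. *)
Definition mono_ser k X : nat -> M :=
  fun a => if (k <= a)%N then act (f k) (X (a - k)%N) else 0.

Lemma conv_ge_split k X :
  conv (ge_coef k.+1) X = conv (ge_coef k) X - mono_ser k X.
Proof.
apply/funext => a; rewrite addrfctE opprfctE /conv /mono_ser.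
apply/eqP; rewrite eq_sym subr_eq; apply/eqP.
case: ifPn => ka; last first.
  rewrite addr0; apply: eq_bigr => p _; rewrite /ge_coef.
  have kp : k != p by apply: contraNneq ka => ->; rewrite -ltnS.
  by rewrite ltn_neqAle kp.
have ka' : (k < a.+1)%N by [].
rewrite (bigD1 (Ordinal ka')) //= [in RHS](bigD1 (Ordinal ka')) //=.
rewrite /ge_coef leqnn ltnn act0l add0r addrC; congr (_ + _).
apply: eq_bigr => p; rewrite -val_eqE /= => pk.
by rewrite ltn_neqAle eq_sym pk.
Qed.

Lemma mono_ser_conv_ge k k' X :
  conv (ge_coef k') (mono_ser k X) = mono_ser k (conv (ge_coef k') X).
Proof.
have E Y : mono_ser k Y = conv (fun p => (p == k)%:R *: f p) Y.
  apply/funext => a; rewrite /mono_ser /conv; case: ifPn => ka.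
    have ka' : (k < a.+1)%N by [].
    rewrite (bigD1 (Ordinal ka')) //= eqxx scale1r big1 ?addr0 // => p.
    by rewrite -val_eqE /= => /negPf ->; rewrite scale0r act0l.
  rewrite big1 // => p _; have := ltn_ord p; case: eqP => [|_ _]; first by lia.
  by rewrite scale0r act0l.
rewrite !E; apply: (conv_scaled_comm ff) => p; last by exists p, (p == k)%:R.
exists p; rewrite /ge_coef; case: ifP => _; first by exists 1; rewrite scale1r.
by exists 0; rewrite scale0r.
Qed.

Definition ge_pow k r v : nat -> M := iter r (conv (ge_coef k)) (const_ser v).

(* Since [\sum_(p > k) f_p z^p] is [\sum_(p >= k) f_p z^p - f_k z^k], the
   range of vanishing coefficients is inherited when low modes are dropped. *)
Lemma ge_pow_eq0 k (Kk : nat) v :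
  (forall r a, (1 + r * k + Kk <= a + r)%N -> pow_ser f v r a = 0) ->
  forall k' r a, (k' <= k)%N -> (1 + r * k + Kk <= a + r)%N -> ge_pow k' r v a = 0.
Proof.
move=> h; elim=> [|k' IH] r a kk ha.
  rewrite /ge_pow (_ : ge_coef 0 = f); first by apply: h; lia.
  by apply/funext => p; rewrite /ge_coef.
(* Mixed products are needed to exchange one factor at a time: i factors without the mode k' and j
   factors with it. *)
suff claim i j b : (1 + (i + j) * k + Kk <= b + (i + j))%N ->
    iter i (conv (ge_coef k'.+1)) (ge_pow k' j v) b = 0.
  by apply: (claim r 0%N); rewrite addn0.
elim: i j b => [|i IHi] j b hb; first by apply: IH => //; apply: ltnW.
rewrite iterSr conv_ge_split.
have iterB (X Y : nat -> M) : iter i (conv (ge_coef k'.+1)) (X - Y) =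
    iter i (conv (ge_coef k'.+1)) X - iter i (conv (ge_coef k'.+1)) Y.
  by elim: (i) => //= n ->; rewrite convB.
have iterM X : iter i (conv (ge_coef k'.+1)) (mono_ser k' X) =
    mono_ser k' (iter i (conv (ge_coef k'.+1)) X).
  by elim: (i) => //= n ->; rewrite mono_ser_conv_ge.
rewrite iterB iterM addrfctE opprfctE /mono_ser.
have := IHi j.+1 b; rewrite addnS -addSn => /(_ hb); rewrite /ge_pow iterS => ->.
(* The remaining term has one factor less and degree lowered by k'. The bound on b + i + j then
   drops by k while b + i + j drops by k' + 1 <= k, so the range is kept. *)
rewrite sub0r; case: ifPn => kb; last by rewrite oppr0.
by rewrite IHi ?act0r ?oppr0 //; rewrite (addSn i) mulSn in hb; lia.
Qed.

Lemma ge_pow_low k r v :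
  (forall a, (a < r * k)%N -> ge_pow k r v a = 0) /\
  ge_pow k r v (r * k) = iter r (act (f k)) v.
Proof.
elim: r => [|r [IH1 IH2]]; first by split.
have E a : (a <= r.+1 * k)%N -> ge_pow k r.+1 v a =
    if a == (r.+1 * k)%N then act (f k) (ge_pow k r v (r * k)) else 0.
  move=> ha; rewrite /ge_pow iterS -/(ge_pow k r v) /conv /ge_coef.
  case: eqP => [ea|na]; last first.
    apply: big1 => p _; case: ifP => kp; last by rewrite act0l.
    by rewrite IH1 ?act0r //; have := ltn_ord p; rewrite mulSn in ha na; lia.
  have ka : (k < a.+1)%N by rewrite ea mulSn ltnS leq_addr.
  rewrite (bigD1 (Ordinal ka)) //= leqnn big1 ?addr0 => [|p].
    by rewrite ea mulSn addKn.
  rewrite -val_eqE /= => pk; case: ifP => kp; last by rewrite act0l.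
  by rewrite IH1 ?act0r //; have := ltn_ord p; rewrite mulSn in ea; lia.
split=> [a ha|]; first by rewrite E ?(ltnW ha) // ltn_eqF.
by rewrite E // eqxx IH2.
Qed.

(** f_k^n v is the coefficient of z^(nk) in the series truncated to modes at least k, and Kk < n
    puts this index in the vanishing range. *)
Lemma iter_mode_eq0 k (Kk : nat) v n :
  (forall r a, (1 + r * k + Kk <= a + r)%N -> pow_ser f v r a = 0) ->
  (Kk < n)%N -> iter n (act (f k)) v = 0.
Proof.
move=> h Kn; have [_ <-] := ge_pow_low k n v.
by apply: (ge_pow_eq0 h) => //; lia.
Qed.

End PowSerVanishing.

(** * The Killing form *)

Section Trace.
Variables (K : fieldType) (V : vectType K).

(** tr(fg) = tr(gf) with the two traces taken in different bases, which also gives independence of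
    the basis. *)
Lemma trace_comm m n (b : m.-tuple V) (b' : n.-tuple V) (f g : V -> V) :
  basis_of fullv b -> basis_of fullv b' -> linear f -> linear g ->
  \sum_i coord b i (f (g b`_i)) = \sum_j coord b' j (g (f b'`_j)).
Proof.
move=> hb hb' hf hg.
have expand k (c : k.-tuple V) (h : V -> V) v : basis_of fullv c -> linear h ->
    h v = \sum_j coord c j v *: h c`_j.
  move=> hc hh.
  pose h' : {linear V -> V} := HB.pack h (GRing.isLinear.Build _ _ _ _ h hh).
  have -> : h v = h' v by [].
  rewrite {1}(coord_basis hc (memvf v)) linear_sum; apply: eq_bigr => j _.
  by rewrite linearZ.
transitivity (\sum_(i < m) \sum_(j < n) coord b' j (g b`_i) * coord b i (f b'`_j)).
  apply: eq_bigr => i _; rewrite (expand _ b' f (g _)) // linear_sum.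
  by apply: eq_bigr => j _; rewrite linearZ.
rewrite exchange_big; apply: eq_bigr => j _.
rewrite (expand _ b g (f _)) // linear_sum.
by apply: eq_bigr => i _; rewrite linearZ mulrC.
Qed.

End Trace.

Section Killing.
Variables (R : realType) (g : fdLieAlgType R[i]).
Local Notation C := R[i].
Implicit Types (x y z : g).
Local Notation b := (vbasis (fullv : {vspace g})).
Local Notation fullb := (vbasisP (fullv : {vspace g})).

Lemma ad_linear x : linear (lie x).
Proof. by move=> a y z; rewrite lieDr lieZr. Qed.

Lemma ad2_linear x y : linear (fun z => lie x (lie y z)).
Proof. by move=> a z t; rewrite !(lieDr, lieZr). Qed.

Lemma killingC x y : killing x y = killing y x.
Proof. exact: trace_comm fullb fullb (ad_linear x) (ad_linear y). Qed.

Lemma killingDl x y z : killing (x + y) z = killing x z + killing y z.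
Proof. by rewrite -big_split; apply: eq_bigr => i _; rewrite lieDl linearD. Qed.

Lemma killingZl a x y : killing (a *: x) y = a * killing x y.
Proof. by rewrite mulr_sumr; apply: eq_bigr => i _; rewrite lieZl linearZ. Qed.

Lemma killingDr x y z : killing x (y + z) = killing x y + killing x z.
Proof. by rewrite killingC killingDl !(killingC x). Qed.

Lemma killingZr a x y : killing x (a *: y) = a * killing x y.
Proof. by rewrite killingC killingZl killingC. Qed.

Lemma killing0l x : killing 0 x = 0.
Proof. by rewrite -[0 in LHS](scale0r 0) killingZl mul0r. Qed.

Lemma killing0r x : killing x 0 = 0.
Proof. by rewrite killingC killing0l. Qed.

Lemma killingNl x y : killing (- x) y = - killing x y.
Proof. by rewrite -scaleN1r killingZl mulN1r. Qed.

Lemma killing_suml I (r : seq I) P (F : I -> g) y :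
  killing (\sum_(i <- r | P i) F i) y = \sum_(i <- r | P i) killing (F i) y.
Proof.
by elim/big_rec2: _ => [|i c u _ <-]; rewrite ?killing0l ?killingDl.
Qed.

Lemma killing_sumr I (r : seq I) P (F : I -> g) y :
  killing y (\sum_(i <- r | P i) F i) = \sum_(i <- r | P i) killing y (F i).
Proof. by rewrite killingC killing_suml; apply: eq_bigr => i _; rewrite killingC. Qed.

(** The two sides expand to tr(xyz) - tr(yxz) and tr(xyz) - tr(xzy), and the trace is cyclic. *)
Lemma killing_invariant x y z : killing (lie x y) z = killing x (lie y z).
Proof.
have ad (u v t : g) : lie (lie u v) t = lie u (lie v t) - lie v (lie u t).
  exact: (@adjoint_act_lie _ g).
transitivity (\sum_i coord b i (lie x (lie y (lie z b`_i))) -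
              \sum_i coord b i (lie y (lie x (lie z b`_i)))).
  by rewrite -sumrB; apply: eq_bigr => i _; rewrite ad linearB.
rewrite (trace_comm fullb fullb (ad_linear y) (ad2_linear x z)) -sumrB.
by apply: eq_bigr => i _; rewrite ad lieDr liexN linearB.
Qed.

Lemma ad_eigenbasis x : ad_semisimple x ->
  exists n (c : n.-tuple g) (d : nat -> C), basis_of fullv c /\
    forall i : 'I_n, lie x c`_i = d i *: c`_i.
Proof.
move=> [c hc he]; have /choice[d hd] v : exists a, v \in c -> lie x v = a *: v.
  by have [/he[a ha]|_] := boolP (v \in c); [exists a | exists 0].
exists (size c), (in_tuple c), (fun i => d c`_i); split=> // i.
by apply: hd; apply: mem_nth.
Qed.

(** The list is the spectrum of ad x with multiplicities, read off an eigenbasis. *)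
Lemma killing_eigen x : ad_semisimple x ->
  exists s : seq C, [/\ killing x x = \sum_(c <- s) c ^+ 2,
    forall v c, v != 0 -> lie x v = c *: v -> c \in s
  & forall c, c \in s -> exists2 v, v != 0 & lie x v = c *: v].
Proof.
move=> /ad_eigenbasis[n [c [d [hc hd]]]].
have fc := basis_free hc.
exists [seq d i | i : 'I_n]; split=> [|v a v0 hv|a /mapP[i _ ->]].
- rewrite big_map big_enum /=.
  rewrite /killing (trace_comm fullb hc (ad_linear x) (ad_linear x)).
  apply: eq_bigr => i _; rewrite hd lieZr hd scalerA linearZ /= coord_free //.
  by rewrite eqxx mulr1 expr2.
- have [i hi] : exists i, coord c i v != 0.
    apply: contrapT => h; case/eqP: v0.
    rewrite (coord_basis hc (memvf v)) big1 // => i _.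
    have /eqP -> : coord c i v == 0 by apply/negPn/negP => ci; apply: h; exists i.
    by rewrite scale0r.
  apply/mapP; exists i; rewrite ?mem_enum //.
  have : coord c i (lie x v) = a * coord c i v by rewrite hv linearZ.
  rewrite {1}(coord_basis hc (memvf v)) lie_sumr linear_sum (bigD1 i) //= big1.
    rewrite addr0 lieZr hd !linearZ /= coord_free // eqxx mulr1.
    by rewrite mulrC => /(mulIf hi) ->.
  by move=> j ji; rewrite lieZr hd !linearZ /= coord_free // (negPf ji) !mulr0.
- exists c`_i; last exact: hd.
  apply/eqP => c0; have := coord_free i i fc; rewrite c0 linear0 eqxx.
  by move/esym/eqP; rewrite oner_eq0.
Qed.

End Killing.

(** Otherwise the distinct numbers c + k d would all be eigenvalues of ad h, which has finitely
    many. *)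
Lemma raise_to_zero (R : realType) (g : fdLieAlgType R[i]) (h y : g) (d : R[i]) :
  ad_semisimple h -> lie h y = d *: y -> d != 0 ->
  forall v c, lie h v = c *: v -> exists k, iter k (lie y) v = 0.
Proof.
move=> /killing_eigen[s [_ hs _]] hy d0 v c hv; apply: contrapT => hn.
have hk k : c + k%:R * d \in s.
  apply: (hs (iter k (lie y) v)); first by apply/eqP => h0; apply: hn; exists k.
  exact: (@iter_act_mul _ _ (adjoint g) _ _ _ _ v hy).
have /uniq_leq_size : uniq [seq c + k%:R * d | k <- iota 0 (size s).+1].
  rewrite map_inj_uniq ?iota_uniq // => k k' /addrI /(mulIf d0) /eqP.
  by rewrite eqr_nat => /eqP.
move=> /(_ s); rewrite size_map size_iota ltnn => h0.
by suff: false by []; apply: h0 => _ /mapP[k _ ->].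
Qed.

(** * Integrality of coroots and positivity of the form on roots *)

Section CartanForm.
Variables (R : realType) (g : fdLieAlgType R[i]) (X : root_data g).
Local Notation C := R[i].
Local Notation H := (csa X).
Local Notation Rp := (pos_root (@simple_root _ _ X)).
Local Notation alpha := (@simple_root _ _ X).
Implicit Types (a b : dual H) (c : C) (t h : subvs_of H) (x y z v : g).

Lemma ad_semisimple_csa h : ad_semisimple (vsval h).
Proof. by have [_ + _] := csaP X; apply; apply: subvsP. Qed.

Lemma csa_abelian h t : lie (vsval h) (vsval t) = 0.
Proof. by have [+ _ _] := csaP X; apply; apply: subvsP. Qed.

Lemma csa_centralizer x : (forall h, lie (vsval h) x = 0) -> x \in H.
Proof.
by have [_ _ +] := csaP X; move=> hc hx; apply: hc => y yH; rewrite -(vsprojK yH).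
Qed.

Lemma pos_simple_root i : Rp (alpha i).
Proof.
have [hr _ _] := simple_rootP X; split=> //.
exists (fun j => (j == i)%N); rewrite (bigD1 i) //= eqxx scale1r big1 ?addr0 // => j.
by move=> /negPf ->; rewrite scale0r.
Qed.

Lemma pos_root_sl2 a : Rp a ->
  [/\ lie (xp X a) (xm X a) = cow a, lie (cow a) (xp X a) = 2 *: xp X a
    & lie (cow a) (xm X a) = - (2 *: xm X a)].
Proof.
by move=> ha; have [_ _ ?] := xpP ha; have [_ _ ?] := xmP ha; rewrite (xpmP ha).
Qed.

Lemma coroot_eigen_nat a v c : Rp a -> v != 0 -> lie (cow a) v = c *: v ->
  lie (xp X a) v = 0 -> exists n, c = n%:R.
Proof.
move=> ha v0 hv ev; have [h1 h2 h3] := pos_root_sl2 ha.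
have h3' : lie (cow a) (xm X a) = - 2 *: xm X a by rewrite h3 scaleNr.
have [|k hk] := raise_to_zero (ad_semisimple_csa _) h3' _ hv.
  by rewrite oppr_eq0 pnatr_eq0.
have [n [_ -> _]] := @sl2_highest_weight _ _ (adjoint g) _ _ _ h1 h3 v c k v0 ev hv hk.
by exists n.
Qed.

(** The last nonzero vector e^m v is a highest weight vector, so its eigenvalue c + 2m is a natural
    number. *)
Lemma coroot_eigen_int a v c : Rp a -> v != 0 -> lie (cow a) v = c *: v ->
  exists m : int, c = m%:~R.
Proof.
move=> ha v0 hv; have [h1 h2 h3] := pos_root_sl2 ha.
have [|k hk] := raise_to_zero (ad_semisimple_csa _) h2 _ hv; first by rewrite pnatr_eq0.
have hex : exists k, iter k (lie (xp X a)) v == 0 by exists k; apply/eqP.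
case: (ex_minnP hex) => -[|m] /eqP hm hmin; first by case/eqP: v0.
have u0 : iter m (lie (xp X a)) v != 0.
  by apply/eqP => h0; have := hmin m; rewrite h0 eqxx ltnn => /(_ isT).
have [n hn] := coroot_eigen_nat ha u0
  (@iter_act_mul _ _ (adjoint g) _ _ _ m v h2 c hv) hm.
exists (n%:Z - m%:Z * 2); rewrite intrD intrN intrM -!pmulrn -hn.
by rewrite addrK.
Qed.

Lemma killing_coroot_gt0 a : Rp a -> 0 < killing (cow a) (cow a).
Proof.
move=> ha; have [s [-> hs hs']] := killing_eigen (ad_semisimple_csa (coroot a)).
have h2 : 2 \in s.
  by have [x0 _ h] := xpP ha; apply: hs h.
have sq c : c \in s -> 0 <= c ^+ 2.
  move=> /hs'[v v0 hv]; have [m ->] := coroot_eigen_int ha v0 hv.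
  by rewrite real_exprn_even_ge0 // realz.
rewrite (big_rem _ h2) /= ltr_pwDl ?exprn_gt0 //.
rewrite big_seq; apply: sumr_ge0 => c hc; apply: sq; exact: mem_rem hc.
Qed.

(** If no representing element existed, [kdual a] would be the default 0, hence the coroot would be
    0, yet it acts by 2 on the nonzero root vector. *)
Lemma kdual_pos a : Rp a -> forall h, killing (vsval (kdual a)) (vsval h) = a h.
Proof.
move=> ha; rewrite /kdual; case: xgetP => [t -> //|hn].
have k0 : kdual a = 0.
  by rewrite /kdual; case: xgetP => // t _ ht; case: (hn t).
have [x0 _ h2] := xpP ha; case/eqP: x0.
have : 2 *: xp X a = 0 by rewrite -h2 /coroot k0 scaler0 linear0 lie0x.
by move/eqP; rewrite scaler_eq0 pnatr_eq0 => /eqP.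
Qed.

Lemma kform_pos a : Rp a -> 0 < kform a a.
Proof.
move=> ha; have := killing_coroot_gt0 ha.
rewrite /cow /coroot linearZ /= killingZl killingZr -/(kform a a).
(* The positive number killing(h_a, h_a) is (2 / (a, a))^2 (a, a); the value (a, a) = 0 would make
   it 0. *)
have [->|k0] := eqVneq (kform a a) 0; first by rewrite !mulr0 ltxx.
by rewrite divfK // pmulr_lgt0 // pmulr_rgt0 // invr_gt0.
Qed.

Lemma dualZ a c t : a (c *: t) = c * a t :> C.
Proof. by rewrite linearZ. Qed.

Lemma root_at_coroot a b : Rp a -> b (kdual a) = kform a a / 2 * b (coroot a) :> C.
Proof.
move=> ha; rewrite /coroot dualZ mulrA mulf_div [2 * _]mulrC divff ?mul1r //.
by rewrite mulf_neq0 ?pnatr_eq0 // lt0r_neq0 // kform_pos.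
Qed.

End CartanForm.

(** * The form on the dual of the Cartan subalgebra *)

Section DualForm.
Variables (R : realType) (g : fdLieAlgType R[i]) (X : root_data g).
Local Notation C := R[i].
Local Notation H := (csa X).
Local Notation Rp := (pos_root (@simple_root _ _ X)).
Local Notation alpha := (@simple_root _ _ X).
Local Notation n := (rank X).
Implicit Types (a b : dual H) (c : C) (t h : subvs_of H) (x y z v : g) (i j : 'I_n).

Definition simple_tuple := [tuple alpha i | i < n].

Lemma simple_tuple_basis : basis_of fullv simple_tuple.
Proof. by have [_ + _] := simple_rootP X; congr basis_of. Qed.

Lemma simple_tuple_nth i : simple_tuple`_i = alpha i.
Proof. by rewrite -tnth_nth tnth_mktuple. Qed.

Definition simple_coord i a : C := coord simple_tuple i a.

Lemma simple_coordE a : a = \sum_i simple_coord i a *: alpha i.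
Proof.
rewrite {1}(coord_basis simple_tuple_basis (memvf a)).
by apply: eq_bigr => i _; rewrite simple_tuple_nth.
Qed.

Lemma simple_coord_sum (k : 'I_n -> C) i :
  simple_coord i (\sum_j k j *: alpha j) = k i.
Proof.
have fb := basis_free simple_tuple_basis.
rewrite /simple_coord linear_sum (bigD1 i) //= big1 ?addr0.
  by rewrite linearZ /= -simple_tuple_nth coord_free // eqxx mulr1.
move=> j ji; rewrite linearZ /= -simple_tuple_nth coord_free // (negPf ji).
by rewrite mulr0.
Qed.

Lemma simple_coord_alpha i j : simple_coord i (alpha j) = (i == j)%:R.
Proof.
rewrite -[alpha j](_ : \sum_k (k == j)%:R *: alpha k = _) ?simple_coord_sum //.
rewrite (bigD1 j) //= eqxx scale1r big1 ?addr0 // => k /negPf ->.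
by rewrite scale0r.
Qed.

Lemma dual_sumE I (r : seq I) P (F : I -> dual H) t :
  ((\sum_(k <- r | P k) F k) t : C) = \sum_(k <- r | P k) (F k t : C).
Proof. by rewrite sum_lfunE. Qed.

Lemma dual_separates t : (forall a, a t = 0 :> C) -> t = 0.
Proof.
move=> ht; have hb := vbasisP (fullv : {vspace (subvs_of H)}).
rewrite (coord_basis hb (memvf t)) big1 // => k _.
pose f (u : subvs_of H) : C^o := coord (vbasis fullv) k u.
have hf : linear f by move=> c u v; rewrite /f linearP.
pose F : {linear subvs_of H -> C^o} := HB.pack f (GRing.isLinear.Build _ _ _ _ f hf).
by have := ht (linfun F); rewrite lfunE /= /f => ->; rewrite scale0r.
Qed.

(** Representing elements exist for the simple roots, which form a basis of the dual. *)
Lemma kdual_ex a : exists t, forall h, killing (vsval t) (vsval h) = a h.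
Proof.
exists (\sum_i simple_coord i a *: kdual (alpha i)) => h.
rewrite linear_sum killing_suml [in RHS](simple_coordE a) dual_sumE.
apply: eq_bigr => i _.
by rewrite linearZ killingZl (kdual_pos (pos_simple_root i)) scale_lfunE.
Qed.

Lemma kdualP a h : killing (vsval (kdual a)) (vsval h) = a h.
Proof.
rewrite /kdual; case: xgetP => [t -> //|hn].
by have [t /hn] := kdual_ex a.
Qed.

(** Pairing the difference with t_b evaluates b on it, and the functionals b separate points. *)
Lemma kdual_uniq a t : (forall h, killing (vsval t) (vsval h) = a h) -> t = kdual a.
Proof.
move=> ht; apply/eqP; rewrite -subr_eq0; apply/eqP/dual_separates => b.
rewrite -kdualP killingC linearB /= killingDl killingNl.
by rewrite ht kdualP subrr.
Qed.

Lemma kdual_surj t : exists a, t = kdual a.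
Proof.
pose f (h : subvs_of H) : C^o := killing (vsval t) (vsval h).
have hf : linear f by move=> c u v; rewrite /f linearP killingDr killingZr.
pose F : {linear subvs_of H -> C^o} := HB.pack f (GRing.isLinear.Build _ _ _ _ f hf).
by exists (linfun F); apply: kdual_uniq => h; rewrite lfunE.
Qed.

Lemma kformE a b : kform a b = b (kdual a).
Proof. by rewrite /kform killingC kdualP. Qed.

Lemma kformC a b : kform a b = kform b a.
Proof. exact: killingC. Qed.

Lemma kformDr a b b' : kform a (b + b') = kform a b + kform a b'.
Proof. by rewrite !kformE add_lfunE. Qed.

Lemma kformZr c a b : kform a (c *: b) = c * kform a b.
Proof. by rewrite !kformE scale_lfunE. Qed.

Lemma kformDl a b b' : kform (b + b') a = kform b a + kform b' a.
Proof. by rewrite kformC kformDr !(kformC a). Qed.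

Lemma kformZl c a b : kform (c *: b) a = c * kform b a.
Proof. by rewrite kformC kformZr kformC. Qed.

Lemma kform_sumr I (r : seq I) P (F : I -> dual H) a :
  kform a (\sum_(k <- r | P k) F k) = \sum_(k <- r | P k) kform a (F k).
Proof. by rewrite kformE dual_sumE; apply: eq_bigr => k _; rewrite kformE. Qed.

Lemma kform_suml I (r : seq I) P (F : I -> dual H) a :
  kform (\sum_(k <- r | P k) F k) a = \sum_(k <- r | P k) kform (F k) a.
Proof. by rewrite kformC kform_sumr; apply: eq_bigr => k _; rewrite kformC. Qed.

Lemma kform_coroot a b : Rp a -> kform a b = kform a a / 2 * b (coroot a).
Proof. by move=> ha; rewrite kformE root_at_coroot. Qed.

Lemma csa_span t : exists k : 'I_n -> C, t = \sum_i k i *: coroot (alpha i).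
Proof.
have [a ->] := kdual_surj t.
exists (fun i => simple_coord i a * (kform (alpha i) (alpha i) / 2)).
apply/esym/kdual_uniq => h.
rewrite linear_sum killing_suml [in RHS](simple_coordE a) dual_sumE.
apply: eq_bigr => i _; have ha := pos_simple_root i.
rewrite scale_lfunE /coroot scalerA linearZ killingZl kdualP.
congr (_ * _); rewrite -mulrA mulf_div [2 * _]mulrC divff ?mulr1 //.
by rewrite mulf_neq0 ?pnatr_eq0 // lt0r_neq0 // kform_pos.
Qed.

End DualForm.

(** * Root spaces *)

Section RootSpaces.
Variables (R : realType) (g : fdLieAlgType R[i]) (X : root_data g).
Local Notation C := R[i].
Local Notation H := (csa X).
Local Notation Rp := (pos_root (@simple_root _ _ X)).
Local Notation alpha := (@simple_root _ _ X).
Local Notation n := (rank X).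
Implicit Types (a b : dual H) (c : C) (t h : subvs_of H) (x y z v : g) (i j : 'I_n).

Lemma root_space0 a : in_root_space a (0 : g).
Proof. by move=> h; rewrite liex0 scaler0. Qed.

Lemma root_spaceD a x y :
  in_root_space a x -> in_root_space a y -> in_root_space a (x + y).
Proof. by move=> hx hy h; rewrite lieDr hx hy scalerDr. Qed.

Lemma root_spaceZ a c x : in_root_space a x -> in_root_space a (c *: x).
Proof. by move=> hx h; rewrite lieZr hx !scalerA mulrC. Qed.

Lemma root_spaceB a x y :
  in_root_space a x -> in_root_space a y -> in_root_space a (x - y).
Proof. by move=> hx hy; rewrite -scaleN1r; apply/root_spaceD/root_spaceZ. Qed.

Lemma root_space_lie a b x y :
  in_root_space a x -> in_root_space b y -> in_root_space (a + b) (lie x y).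
Proof.
move=> hx hy h; have -> : lie (vsval h) (lie x y) =
    lie (lie (vsval h) x) y + lie x (lie (vsval h) y).
  by rewrite (@adjoint_act_lie _ g) subrK.
by rewrite hx hy lieZl lieZr -scalerDl add_lfunE.
Qed.

Lemma root_space_csa x : in_root_space (0 : dual H) x ->
  exists h : subvs_of H, x = vsval h.
Proof.
move=> hx; exists (vsproj H x); rewrite vsprojK //.
by apply: csa_centralizer => h; rewrite hx zero_lfunE scale0r.
Qed.

Lemma root_space_cases a x : in_root_space a x ->
  [\/ x = 0, a = 0, Rp a | Defs.root a /\ nat_comb alpha (- a)].
Proof.
move=> hx; have [->|x0] := eqVneq x 0; first by constructor 1.
have [->|a0] := eqVneq a 0; first by constructor 2.
have ra : Defs.root a by split=> //; exists x.
have [_ _ /(_ _ ra)[ha|ha]] := simple_rootP X; first by constructor 3.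
by constructor 4.
Qed.

(** P passes from the eigenvectors of ad h in the stable subspace K to all of K. A product of
    distinct factors ad h - d kills x, and eigencomponents are split off one factor at a time. *)
Lemma eigen_split (P : g -> Prop) (K : g -> Prop) h :
  P 0 -> (forall x y, P x -> P y -> P (x + y)) ->
  (forall c x y, K x -> K y -> K (c *: x + y)) ->
  (forall x, K x -> K (lie (vsval h) x)) ->
  (forall x c, K x -> lie (vsval h) x = c *: x -> P x) ->
  forall x, K x -> P x.
Proof.
move=> P0 PD KP Kh KE.
pose op c x := lie (vsval h) x - c *: x.
have opP c (a : C) x y : op c (a *: x + y) = a *: op c x + op c y.
  rewrite /op lieDr lieZr scalerDr opprD addrACA; congr (_ + _).
  by rewrite scalerBr !scalerA mulrC.
have op0 c : op c 0 = 0 by rewrite /op liex0 scaler0 subr0.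
pose ops (s : seq C) x := foldr op x s.
have opsP s (a : C) x y : ops s (a *: x + y) = a *: ops s x + ops s y.
  by elim: s => //= c s IH; rewrite IH opP.
have ops0 s : ops s 0 = 0 by elim: s => //= c s ->.
have opsD s x y : ops s (x + y) = ops s x + ops s y.
  by have := opsP s 1 x y; rewrite !scale1r.
have opsZ s (a : C) x : ops s (a *: x) = a *: ops s x.
  by have := opsP s a x 0; rewrite !addr0 ops0 addr0.
have opsE s c x : lie (vsval h) x = c *: x ->
    ops s x = \prod_(d <- s) (c - d) *: x.
  move=> hx; elim: s => [|d s IH]; first by rewrite big_nil scale1r.
  by rewrite big_cons /= IH /op lieZr hx -scalerA (scalerA d) mulrC -scalerA
     -scalerBr -scalerBl scalerA [in RHS]scalerA mulrC.
have op_comm c (d : C) x : op c (op d x) = op d (op c x).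
  rewrite /op !lieDr !liexN !lieZr !scalerBr !scalerA (mulrC c) !opprB.
  by rewrite addrACA [RHS]addrACA; congr (_ + _); rewrite addrC.
have ops_op s c x : ops s (op c x) = op c (ops s x).
  by elim: s => //= d s ->; rewrite op_comm.
have Kop s x : K x -> K (ops s x).
  elim: s => //= c s IH hx; rewrite /op addrC -scaleNr.
  by apply: KP; [apply: IH | apply: Kh; apply: IH].
have [s us hs] : exists2 s, uniq s & forall x, ops s x = 0.
  have [m [b [d [hb hd]]]] := ad_eigenbasis (ad_semisimple_csa h).
  exists (undup [seq d i | i : 'I_m]); first exact: undup_uniq.
  move=> x; rewrite (coord_basis hb (memvf x)).
  elim/big_rec: _ => [|i y _ hy]; first exact: ops0.
  rewrite opsP hy addr0 (opsE _ (d i)) //.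
  rewrite (big_rem (d i)) /= ?subrr ?mul0r ?scale0r ?scaler0 //.
  by rewrite mem_undup; apply: map_f; rewrite mem_enum.
move=> x; move: (hs x); elim: s us x {hs} => [|c s IH] /= us x hx Kx.
  by rewrite hx.
have [cs {}us] := andP us.
pose y := ops s x; pose k := \prod_(d <- s) (c - d).
have hy : lie (vsval h) y = c *: y by apply/eqP; rewrite -subr_eq0 -[_ - _]/(op c y) hx.
have k0 : k != 0.
  rewrite prodf_seq_neq0; apply/allP => d ds /=; rewrite subr_eq0.
  by apply: contraNneq cs => ->.
(* y is a c-eigenvector on which the remaining factors act by k, so x - y / k is killed by these
   factors. *)
rewrite -(subrK (k^-1 *: y) x); apply: PD.
  apply: IH => //; last first.
    by rewrite addrC -scaleNr; apply: KP => //; apply: Kop.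
  by rewrite -scaleNr addrC opsP (opsE s c) // scalerA mulNr mulVf // scaleN1r addNr.
apply: (KE _ c); last by rewrite lieZr hy !scalerA mulrC.
have K0 : K 0 by have := KP (-1) x x Kx Kx; rewrite scaleN1r addNr.
by rewrite -[_ *: _]addr0; apply: KP => //; apply: Kop.
Qed.

(** Simultaneous diagonalization: elements of a basis of H are treated one at a time by
    [eigen_split]. *)
Lemma root_space_ind (P : g -> Prop) :
  P 0 -> (forall x y, P x -> P y -> P (x + y)) ->
  (forall a x, in_root_space a x -> P x) -> forall x, P x.
Proof.
move=> P0 PD PR.
suff claim (hs : seq (subvs_of H)) : forall P : g -> Prop,
    P 0 -> (forall x y, P x -> P y -> P (x + y)) ->
    (forall x (f : subvs_of H -> C),
       (forall h, h \in hs -> lie (vsval h) x = f h *: x) -> P x) -> forall x, P x.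
  apply: (claim (vbasis fullv)) => // x f hf.
  have [->//|x0] := eqVneq x 0.
  have hb := vbasisP (fullv : {vspace (subvs_of H)}).
  have eig h : exists c, lie (vsval h) x = c *: x.
    rewrite (coord_basis hb (memvf h)).
    exists (\sum_i coord (vbasis fullv) i h
      * f (vbasis (fullv : {vspace (subvs_of H)}))`_i).
    rewrite linear_sum lie_suml scaler_suml; apply: eq_bigr => i _.
    rewrite linearZ lieZl hf ?scalerA //.
    by apply: mem_nth; rewrite size_tuple.
  have [k hk] : exists k, coord (vbasis (fullv : {vspace g})) k x != 0.
    apply: contrapT => hn; case/eqP: x0.
    rewrite (coord_vbasis (memvf x)) big1 // => k _.
    have /eqP -> : coord (vbasis fullv) k x == 0.
      by apply/negPn/negP => ck; apply: hn; exists k.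
    by rewrite scale0r.
  (* The eigenvalue is read off a nonzero coordinate of x, which makes it linear in h. *)
  pose e (h : subvs_of H) : C^o :=
    (coord (vbasis (fullv : {vspace g})) k x)^-1
      * coord (vbasis fullv) k (lie (vsval h) x).
  have he : linear e.
    move=> c u v; rewrite /e linearP lieDl lieZl linearP mulrDr /=.
    by rewrite mulrCA.
  pose E : {linear subvs_of H -> C^o} := HB.pack e (GRing.isLinear.Build _ _ _ _ e he).
  apply: (PR (linfun E)) => h; rewrite lfunE /= /e.
  have [c ->] := eig h; rewrite linearZ /= mulrC mulfK //.
elim: hs => {P P0 PD PR} [|h hs IH] P P0 PD PR; first by move=> x; apply: (PR x 0).
apply: IH => // x f hf.
pose K (y : g) := forall t, t \in hs -> lie (vsval t) y = f t *: y.
apply: (@eigen_split P K h) => // [c y z hy hz t ht|y hy t ht|y c hy hc].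
- by rewrite lieDr lieZr hy // hz // scalerDr !scalerA mulrC.
- have -> : lie (vsval t) (lie (vsval h) y) =
      lie (lie (vsval t) (vsval h)) y + lie (vsval h) (lie (vsval t) y).
    by rewrite (@adjoint_act_lie _ g) subrK.
  by rewrite csa_abelian lie0x add0r hy // lieZr.
- apply: (PR y (fun t => if t == h then c else f t)) => t.
  by rewrite inE; case: eqP => [->|_ /= /hy].
Qed.

(** The sum of the weight spaces, that of weight 0 included, for weights other than a. *)
Definition off_root a x := exists s : seq (g * dual H),
  (forall p, p \in s -> in_root_space p.2 p.1 /\ p.2 != a) /\ x = \sum_(p <- s) p.1.

Lemma off_root0 a : off_root a 0.
Proof. by exists [::]; rewrite big_nil. Qed.

Lemma off_rootD a x y : off_root a x -> off_root a y -> off_root a (x + y).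
Proof.
move=> [s [hs ->]] [t [ht ->]]; exists (s ++ t); rewrite big_cat; split=> // p.
by rewrite mem_cat => /orP[/hs|/ht].
Qed.

Lemma off_rootZ a c x : off_root a x -> off_root a (c *: x).
Proof.
move=> [s [hs ->]]; exists [seq (c *: p.1, p.2) | p <- s]; split.
  by move=> _ /mapP[p /hs[h1 h2] ->]; split=> //; apply: root_spaceZ.
by rewrite big_map scaler_sumr.
Qed.

Lemma off_root_in a b x : in_root_space b x -> b != a -> off_root a x.
Proof.
move=> hx ba; exists [:: (x, b)]; rewrite big_seq1; split=> // p.
by rewrite inE => /eqP ->.
Qed.

Lemma dual_neq a b : a != b -> exists t, a t != b t.
Proof.
move=> ab; apply: contrapT => hn; case/eqP: ab; apply/lfunP => t.
by apply/eqP/negPn/negP => h; apply: hn; exists t.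
Qed.

(** Independence of weight spaces: applying ad t - p.2(t), with t separating a from p.2, removes one
    summand and rescales x by a nonzero factor. *)
Lemma off_root_eq0 a x : off_root a x -> in_root_space a x -> x = 0.
Proof.
move=> [s [hs ex]]; move: {2}(size s) (leqnn (size s)) => m.
elim: m s x hs ex => [|m IH] [|p s] x hs ex hm hx //; rewrite ?big_nil // in ex.
have [hp pa] := hs p (mem_head _ _).
have [t ht] := dual_neq pa.
have E : (a t - p.2 t : C) *: x = \sum_(q <- s) (q.2 t - p.2 t : C) *: q.1.
  rewrite scalerBl -hx ex lie_sumr scaler_sumr -sumrB big_cons hp subrr add0r.
  apply: eq_big_seq => q qs; have [hq _] := hs q (@mem_behead _ (p :: s) _ qs).
  by rewrite hq scalerBl.
have /eqP : (a t - p.2 t : C) *: x = 0.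
  apply: (IH [seq ((q.2 t - p.2 t : C) *: q.1, q.2) | q : g * dual H <- s]).
  - move=> _ /mapP[q qs ->]; have [h1 h2] := hs q (@mem_behead _ (p :: s) _ qs).
    by split=> //; apply: root_spaceZ.
  - by rewrite big_map.
  - by rewrite size_map.
  - exact: root_spaceZ.
by rewrite scaler_eq0 subr_eq0 eq_sym (negPf ht) => /eqP.
Qed.

(** The finitely many basis vectors of g involve finitely many weights; for any other a all of g
    lies in [off_root a], so the a-space is 0. *)
Lemma finitely_many_roots : exists s : seq (dual H), forall a, Defs.root a -> a \in s.
Proof.
have [s hs] : exists s : seq (dual H), forall a, a \notin s -> forall x, off_root a x.
  suff claim (b : seq g) : exists s : seq (dual H), forall a, a \notin s ->
      forall x, x \in b -> off_root a x.
    have [s hs] := claim (vbasis (fullv : {vspace g})); exists s => a /hs ha x.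
    rewrite (coord_vbasis (memvf x)); elim/big_rec: _ => [|i y _ hy].
      exact: off_root0.
    apply: off_rootD => //; apply/off_rootZ/ha/mem_nth.
    by rewrite size_tuple.
  elim: b => [|x b [s hs]]; first by exists [::].
  have [s' hs'] : exists s : seq (dual H), forall a, a \notin s -> off_root a x.
    elim/root_space_ind: x => [|x y [s1 h1] [s2 h2]|a x hx].
    - by exists [::] => a _; apply: off_root0.
    - exists (s1 ++ s2) => a; rewrite mem_cat negb_or => /andP[/h1 ? /h2 ?].
      exact: off_rootD.
    - exists [:: a] => b'; rewrite inE eq_sym => ba; exact: off_root_in ba.
  exists (s' ++ s) => a; rewrite mem_cat negb_or => /andP[/hs' h1 /hs h2] y.
  by rewrite inE => /predU1P[->|/h2].
exists s => a [_ [x x0 hx]]; apply: contrapT => /negP/hs ha.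
by case/eqP: x0; apply: off_root_eq0 hx.
Qed.

End RootSpaces.

(** U is a subspace of maximal dimension among those on which P holds. *)
Lemma subspace_of_pred (K : fieldType) (V : vectType K) (P : V -> Prop) :
  P 0 -> (forall c x y, P x -> P y -> P (c *: x + y)) ->
  exists U : {vspace V}, forall x, x \in U <-> P x.
Proof.
move=> P0 PP.
pose Q (U : {vspace V}) := forall x, x \in U -> P x.
pose dims d := `[< exists2 U, Q U & \dim U = d >].
have ex : exists d, dims d.
  exists 0%N; apply/asboolP; exists 0%VS; last by rewrite dimv0.
  by move=> x; rewrite memv0 => /eqP ->.
have bd d : dims d -> (d <= \dim (fullv : {vspace V}))%N.
  by move=> /asboolP[U _ <-]; apply: dimvS; apply: subvf.
case: (ex_maxnP ex bd) => m /asboolP[U QU <-] hmax; exists U => x.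
split; first exact: QU.
move=> Px; apply: contrapT => /negP xU.
have QU' : Q (U + <[x]>)%VS.
  move=> y /memv_addP[u uU [_ /vlineP[c ->] ->]]; rewrite addrC.
  by apply: PP => //; apply: QU.
have := hmax _ (introT (asboolP _) (ex_intro2 _ _ (U + <[x]>)%VS QU' erefl)).
rewrite leqNgt => /negP; apply.
rewrite ltn_neqAle dimvS ?addvSl // andbT; apply/eqP => e.
case/negP: xU; have /eqP -> : U == (U + <[x]>)%VS by rewrite eqEdim addvSl e leqnn.
by rewrite memvE addvSr.
Qed.

Lemma real_seq_max (K : numDomainType) (s : seq K) x :
  x \in s -> {in s, forall y, y \is Num.real} ->
  exists2 m, m \in s & {in s, forall y, y <= m}.
Proof.
elim: s x => [|y s IH] x // _ hs; case: s IH hs => [|z s] IH hs.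
  by exists y => [|t]; rewrite ?mem_head // inE => /eqP ->.
have [|m ms hm] := IH z (mem_head _ _).
  by move=> t ts; apply: hs; rewrite inE ts orbT.
have hm' := hs m (mem_behead (s := y :: z :: s) ms).
have /orP[ym|my] := real_comparable (hs y (mem_head _ _)) hm'.
  exists m; first by rewrite inE ms orbT.
  by move=> t; rewrite inE => /predU1P[->|/hm].
exists y; first exact: mem_head.
by move=> t; rewrite inE => /predU1P[->//|/hm tm]; apply: le_trans my.
Qed.

(** * Root lengths, nondegeneracy and generation of the nilradical *)

Section SimpleAlgebra.
Variables (R : realType) (g : fdLieAlgType R[i]) (X : root_data g).
Local Notation C := R[i].
Local Notation H := (csa X).
Local Notation Rp := (pos_root (@simple_root _ _ X)).
Local Notation alpha := (@simple_root _ _ X).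
Local Notation n := (rank X).
Implicit Types (a b : dual H) (c : C) (t h : subvs_of H) (x y z v : g) (i j : 'I_n).

Lemma root_coroot_int a b x : Rp a -> x != 0 -> in_root_space b x ->
  exists m : int, b (coroot a) = m%:~R :> C.
Proof. by move=> ha x0 /(_ (coroot a)); apply: coroot_eigen_int. Qed.

Lemma simple_coroot_int i j : exists m : int, alpha j (coroot (alpha i)) = m%:~R :> C.
Proof.
have [x0 hx _] := xpP (pos_simple_root j).
exact: root_coroot_int (pos_simple_root i) x0 hx.
Qed.

Lemma kform_simple_real i j : kform (alpha i) (alpha j) \is Num.real.
Proof.
have hi := pos_simple_root i; have [m hm] := simple_coroot_int i j.
rewrite kform_coroot // hm realM ?realz // realM ?realV ?realn //.
by rewrite gtr0_real // kform_pos.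
Qed.

Lemma kform_root_real b : Defs.root b -> kform b b \is Num.real.
Proof.
have comb a : nat_comb alpha a -> kform a a \is Num.real.
  move=> [k ->]; rewrite kform_suml; apply: sum_real => i _.
  rewrite kform_sumr; apply: sum_real => j _.
  by rewrite kformZl kformZr !realM ?realn ?kform_simple_real.
have [_ _ hr] := simple_rootP X; move=> /hr[|] /comb //.
by rewrite -scaleN1r kformZl kformZr !mulN1r opprK.
Qed.

(** The roots are finite in number and their square lengths are real, so a maximum exists and
    [long_sq] is not the default 0. *)
Lemma long_sq_ge a : Defs.root a -> kform a a <= long_sq H.
Proof.
move=> ha; have [s hs] := finitely_many_roots X.
pose s' := [seq kform b b | b <- s & `[< Defs.root b >]].
have mem b : Defs.root b -> kform b b \in s'.
  move=> hb; apply/mapP; exists b => //.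
  by rewrite mem_filter hs // andbT; apply/asboolP.
have [|m ms hm] := real_seq_max (mem a ha).
  move=> _ /mapP[b + ->]; rewrite mem_filter => /andP[/asboolP hb _].
  exact: kform_root_real.
rewrite /long_sq; case: xgetP => [t -> [_ /(_ a ha)] //|/(_ m)]; case.
split; last by move=> b /mem /hm.
by have /mapP[b + ->] := ms; rewrite mem_filter => /andP[/asboolP hb _]; exists b.
Qed.

(** In the normalized form 2 / (a, a) is the ratio of the long square length to that of a, hence at
    least 1. *)
Lemma dcoef_gt0 a : Rp a -> (0 < dcoef a)%N.
Proof.
move=> ha; have [ra _] := ha; have k0 := kform_pos ha; have kl := long_sq_ge ra.
have l0 : 0 < long_sq H by apply: lt_le_trans kl.
have : 1 <= 2 / nform a a.
  rewrite /nform; have -> : 2 / (2 / long_sq H * kform a a) = long_sq H / kform a a.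
    by rewrite !invfM invrK mulrA mulVKf ?pnatr_eq0.
  by rewrite ler_pdivlMr // mul1r.
rewrite /dcoef /natC lecE => /andP[_ h1].
by rewrite truncn_gt0.
Qed.

Hypothesis gs : simple_lie g.

(** The radical is an ideal, and it is not all of g because (alpha_i, alpha_i) > 0 for a simple
    root. *)
Lemma killing_nondegenerate x : (0 < n)%N -> (forall y, killing x y = 0) -> x = 0.
Proof.
move=> n0; pose i0 := Ordinal n0.
have [_ hI] := gs.
have [U hU] : exists U : {vspace g}, forall x, x \in U <-> forall y, killing x y = 0.
  apply: subspace_of_pred => [y|c y z hy hz t]; first exact: killing0l.
  by rewrite killingDl killingZl hy hz mulr0 addr0.
have [|U0|UT] := hI U.
- move=> y z /hU hz; apply/hU => t.
  by rewrite lieC killingNl killing_invariant hz oppr0.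
- by move=> /hU; rewrite U0 memv0 => /eqP.
- have := kform_pos (pos_simple_root i0).
  have /hU : vsval (kdual (alpha i0)) \in U by rewrite UT memvf.
  by rewrite /kform => ->; rewrite ltxx.
Qed.

(** Pairing with a basis of U maps g to a space of smaller dimension, so the kernel is nonzero. *)
Lemma orthogonal_ex (U : {vspace g}) : U != fullv ->
  exists2 y, y != 0 & forall x, x \in U -> killing y x = 0.
Proof.
move=> UT.
pose f (y : g) : 'rV[C]_(\dim U) := \row_j killing y (vbasis U)`_j.
have hf : linear f by move=> c u v; apply/rowP => j; rewrite !mxE killingDl killingZl.
pose F : {linear g -> 'rV[C]_(\dim U)} := HB.pack f (GRing.isLinear.Build _ _ _ _ f hf).
have hdim : (0 < \dim (lker (linfun F)))%N.
  have := limg_ker_dim (linfun F) fullv; rewrite capfv.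
  have : (\dim (linfun F @: fullv) <= \dim U)%N.
    by apply: leq_trans (dimvS (subvf _)) _; rewrite dimvf /dim /= mul1n.
  have : (\dim U < \dim (fullv : {vspace g}))%N.
    rewrite ltn_neqAle dimvS ?subvf // andbT; apply: contra UT => /eqP e.
    by rewrite eqEdim subvf e leqnn.
  by lia.
exists (vpick (lker (linfun F))); first by rewrite vpick0 -dimv_eq0 -lt0n.
move=> x xU; have := memv_pick (lker (linfun F)).
rewrite memv_ker lfunE /= => /eqP/rowP hF.
rewrite (coord_vbasis xU) killing_sumr big1 // => j _.
by have := hF j; rewrite !mxE killingZr => ->; rewrite mulr0.
Qed.

Definition height a : C := \sum_i simple_coord i a.

Lemma height_comb (k : 'I_n -> nat) :
  height (\sum_i (k i)%:R *: alpha i) = (\sum_i k i)%N%:R.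
Proof. by rewrite natr_sum; apply: eq_bigr => i _; rewrite simple_coord_sum. Qed.

Lemma heightD a b : height (a + b) = height a + height b.
Proof. by rewrite -big_split; apply: eq_bigr => i _; rewrite /simple_coord linearD. Qed.

Lemma heightN a : height (- a) = - height a.
Proof. by rewrite -sumrN; apply: eq_bigr => i _; rewrite /simple_coord linearN. Qed.

Lemma height_alpha i : height (alpha i) = 1.
Proof.
rewrite /height (bigD1 i) //= simple_coord_alpha eqxx big1 ?addr0 // => j.
by rewrite simple_coord_alpha => /negPf ->.
Qed.

Lemma nat_comb_height a : nat_comb alpha a -> a != 0 ->
  exists2 m, (0 < m)%N & height a = m%:R.
Proof.
move=> [k ->] a0; exists (\sum_i k i)%N; last exact: height_comb.
rewrite lt0n; apply: contra a0; rewrite sum_nat_eq0 => /forallP k0.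
by rewrite big1 // => i _; have /eqP -> := k0 i; rewrite scale0r.
Qed.

Lemma root_space_antidominant a y : Rp a -> y != 0 -> in_root_space (- a) y ->
  exists i, lie (xp X (alpha i)) y != 0.
Proof.
move=> ha y0 hy; apply: contrapT => hn.
have ey i : lie (xp X (alpha i)) y = 0.
  by apply/eqP/negPn/negP => h; apply: hn; exists i.
have := kform_pos ha; have [_ [k ek]] := ha.
rewrite {1}ek kform_suml => /lt_geF/negbT/negP; apply; apply: sumr_le0 => i _.
have hi := pos_simple_root i.
rewrite kformZl kform_coroot // mulr_ge0_le0 ?ler0n //.
rewrite mulr_ge0_le0 //; first by rewrite divr_ge0 ?ler0n // ltW // kform_pos.
have [m hm] := coroot_eigen_nat hi y0 (hy (coroot (alpha i))) (ey i).
by rewrite opp_lfunE in hm; rewrite -oppr_ge0 hm ler0n.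
Qed.

(* If P missed a vector of weight a, orthogonality would give y of weight -a that all
   [xp (alpha i)] annihilate, so that (a, a_i) <= 0 for each i and (a, a) <= 0. *)
Lemma nilradical_ind (P : g -> Prop) :
  P 0 -> (forall c x y, P x -> P y -> P (c *: x + y)) ->
  (forall i, P (xp X (alpha i))) ->
  (forall i x, P x -> P (lie (xp X (alpha i)) x)) ->
  forall a x, Rp a -> in_root_space a x -> P x.
Proof.
move=> P0 PP Pe Pl.
have PZ c x : P x -> P (c *: x) by move=> hx; rewrite -[_ *: _]addr0; apply: PP.
have PD x y : P x -> P y -> P (x + y) by move=> hx hy; rewrite -[x]scale1r; apply: PP.
suff claim m a x : Rp a -> height a = m%:R -> in_root_space a x -> P x.
  move=> a x ha; have [ra ca] := ha; have [a0 _] := ra.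
  by have [m _ hm] := nat_comb_height ca a0; apply: claim hm.
elim: m a x => [|m IH] a x ha hm hx.
  have [ra ca] := ha; have [a0 _] := ra.
  have [m m0 hm'] := nat_comb_height ca a0.
  by move/eqP: hm; rewrite hm' eqr_nat; case: m m0 {hm'}.
(* Q describes the subspace of vectors whose a-component satisfies P; the goal is that it is all of
   g. *)
pose Q x := exists y z, [/\ x = y + z, P y, in_root_space a y & off_root a z].
have [U hU] : exists U : {vspace g}, forall x, x \in U <-> Q x.
  apply: subspace_of_pred.
    by exists 0, 0; rewrite addr0; split=> //; [apply: root_space0|apply: off_root0].
  move=> c u v [y [z [-> Py hy hz]]] [y' [z' [-> Py' hy' hz']]].
  exists (c *: y + y'), (c *: z + z'); split.
  - by rewrite scalerDr addrACA.
  - exact: PP.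
  - by apply: root_spaceD => //; apply: root_spaceZ.
  - by apply: off_rootD => //; apply: off_rootZ.
have [/eqP UT|UT] := boolP (U == fullv).
  have /hU[y [z [ex Py hy hz]]] : x \in U by rewrite UT memvf.
  suff z0 : z = 0 by rewrite ex z0 addr0.
  apply: off_root_eq0 hz _; have -> : z = x - y by rewrite ex addrAC subrr add0r.
  exact: root_spaceB.
have n0 : (0 < n)%N.
  have [[a0 _] [k ek]] := ha; rewrite lt0n; apply: contra a0 => /eqP n0.
  by rewrite ek big1 // => -[i hi]; exfalso; move: hi; rewrite n0.
have [y y0 hy] := orthogonal_ex UT.
have offU b v : in_root_space b v -> b != a -> killing y v = 0.
  move=> hv ba; apply/hy/hU; exists 0, v; rewrite add0r; split=> //.
    exact: root_space0.
  exact: off_root_in ba.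
(* y is orthogonal to every weight space but that of a, so [h, y] + a(h) y is orthogonal to all of
   g. *)
have ya : in_root_space (- a) y.
  move=> h; apply/eqP; rewrite -subr_eq0; apply/eqP/killing_nondegenerate => //.
  move=> t; elim/(@root_space_ind _ _ X): t => [|u v hu hv|b v hv].
  - exact: killing0r.
  - by rewrite killingDr hu hv addr0.
  - rewrite killingDl killingNl killingZl lieC killingNl killing_invariant hv.
    rewrite killingZr opp_lfunE mulNr opprK.
    have [->|ba] := eqVneq b a; first by rewrite addNr.
    by rewrite (offU b) // !mulr0 oppr0 addr0.
have [i /eqP []] := root_space_antidominant ha y0 ya.
have [_ hi _] := xpP (pos_simple_root i).
apply: killing_nondegenerate => //.
move=> t; elim/(@root_space_ind _ _ X): t => [|u v hu hv|b v hv].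
- exact: killing0r.
- by rewrite killingDr hu hv addr0.
rewrite lieC killingNl killing_invariant.
have hl := root_space_lie hi hv.
have [e|ne] := eqVneq (alpha i + b) a; last by rewrite (offU _ _ hl ne) oppr0.
suff Pv : P (lie (xp X (alpha i)) v).
  rewrite hy ?oppr0 //; apply/hU; exists (lie (xp X (alpha i)) v), 0.
  by rewrite addr0 -e; split=> //; apply: off_root0.
have [v0|b0|hb|[[b0 _] cb]] := root_space_cases hv.
- by rewrite v0 liex0.
- move: hv; rewrite b0 => /root_space_csa[h ->].
  by rewrite lieC hi -scaleNr; apply: PZ.
- apply/Pl/(IH b) => //; move/eqP: hm.
  by rewrite -e heightD height_alpha mulrSr addrC (inj_eq (addIr 1)) => /eqP.
(* A negative b is excluded by heights: a and -b would have positive heights with sum 1. *)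
- have [k k0 hk] := nat_comb_height cb ltac:(by rewrite oppr_eq0).
  have : height a + height (- b) = 1 by rewrite -e heightD heightN addrK height_alpha.
  rewrite hm hk -natrD => /eqP; rewrite pnatr_eq1; case: k k0 {hk} => // k _.
  by rewrite addnS addSn.
Qed.

End SimpleAlgebra.

Section CurrentTensors.
Variables (K : numFieldType) (g : lieAlgType K).
Implicit Types (x y : g) (p q : {poly K}).

Lemma tensDl x y p : (x + y) ⊗ p = x ⊗ p + y ⊗ p.
Proof. by apply: current_eq => n; rewrite cfunD /= scalerDr. Qed.

Lemma tensZl c x p : (c *: x) ⊗ p = c *: (x ⊗ p).
Proof. by apply: current_eq => n; rewrite cfunZ /= !scalerA mulrC. Qed.

Lemma tens0l p : (0 : g) ⊗ p = 0.
Proof. by apply: current_eq => n; rewrite cfun0 /= scaler0. Qed.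

Lemma tensNl x p : (- x) ⊗ p = - (x ⊗ p).
Proof. by rewrite -scaleN1r tensZl scaleN1r. Qed.

Lemma tens_suml I (r : seq I) P (F : I -> g) p :
  (\sum_(k <- r | P k) F k) ⊗ p = \sum_(k <- r | P k) (F k ⊗ p).
Proof. exact: (big_morph (fun x => x ⊗ p) (fun x y => tensDl x y p) (tens0l p)). Qed.

Lemma lie_tens x y p q : lie (x ⊗ p) (y ⊗ q) = lie x y ⊗ (p * q).
Proof.
apply: current_eq => n; rewrite /= /clie_fun coefM scaler_suml.
by apply: eq_bigr => i _; rewrite /= lieZl lieZr scalerA.
Qed.

End CurrentTensors.

(** By the Leibniz rule y^(j+k) x v is a sum of terms ((ad y)^p x) y^q v with p + q = j + k, so p >=
    j or q >= k. *)
Lemma iter_act_lie_eq0 (K : fieldType) (L : lieAlgType K) (M : lieModType L)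
    (x y : L) (v : M) j k :
  iter j (lie y) x = 0 -> iter k (act y) v = 0 -> iter (j + k) (act y) (act x v) = 0.
Proof.
move: {2}(j + k)%N (erefl (j + k)%N) => m.
elim: m j k x v => [|m IH] [|j] [|k] x v // em.
- by move=> /= -> _; rewrite act0l.
- by move=> x0 _; rewrite [x]x0 act0l iter_act0.
- by move=> _ v0; rewrite [v]v0 act0r iter_act0.
- move=> hj hk; rewrite addSn iterSr actC iter_actD.
  have e1 : (j + k.+1 = m)%N by lia.
  rewrite (IH j k.+1) // -?iterSr // add0r.
  by rewrite addnS -addSn (IH j.+1 k) // -?iterSr // addSn -addnS.
Qed.

Lemma Re_natr (R : realType) k : complex.Re (k%:R : R[i]) = k%:R.
Proof. by rewrite raddfMn. Qed.

(** * Integrability of highest weight modules of g[t] *)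

Section HighestWeight.
Variables (R : realType) (g : fdLieAlgType R[i]) (X : root_data g).
Local Notation C := R[i].
Local Notation H := (csa X).
Local Notation Rp := (pos_root (@simple_root _ _ X)).
Local Notation alpha := (@simple_root _ _ X).
Local Notation n := (rank X).
Variables (M : lieModType (current g)) (w : M) (lam : dual H).
Hypothesis gs : simple_lie g.
Hypothesis dom : dominant lam.
Hypothesis we : forall i f, act (xp X (alpha i) ⊗ f) w = 0.
Hypothesis wh : forall i (s : nat),
  act (cow (alpha i) ⊗t^ s) w = ((lam (coroot (alpha i)) : C) * (s == 0%N)%:R) *: w.
Hypothesis wf : forall i,
  iter (pairing lam (alpha i)).+1 (act (xm X (alpha i) ⊗ 1)) w = 0.
Hypothesis wgen_ind : forall P : M -> Prop, P w -> P 0 ->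
  (forall u v, P u -> P v -> P (u + v)) -> (forall c v, P v -> P (c *: v)) ->
  (forall x v, P v -> P (act x v)) -> forall v, P v.
Implicit Types (a b mu : dual H) (c : C) (t h : subvs_of H) (x y z : g).
Implicit Types (u v : M) (i j : 'I_n).

Lemma act_pos_root a x f : Rp a -> in_root_space a x -> act (x ⊗ f) w = 0.
Proof.
move=> ha hx; move: f; move: x hx.
move=> x hx; apply: (@nilradical_ind _ _ X gs (fun x => forall f, act (x ⊗ f) w = 0)
  _ _ _ _ a) => // {x hx}.
- by move=> f; rewrite tens0l act0l.
- by move=> c y z hy hz f; rewrite tensDl actDl tensZl actZl hy hz scaler0 addr0.
- move=> i y hy f; rewrite -[f]mul1r -lie_tens act_lie hy act0r sub0r.
  by rewrite we act0r oppr0.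
Qed.

Lemma act_csa h (s : nat) :
  act (vsval h ⊗t^ s) w = ((lam h : C) * (s == 0%N)%:R) *: w.
Proof.
have [k ->] := csa_span h.
have -> : lam (\sum_i k i *: coroot (alpha i)) =
    \sum_i k i * lam (coroot (alpha i)) :> C.
  by rewrite linear_sum; apply: eq_bigr => i _; apply: dualZ.
rewrite linear_sum tens_suml act_sum_l mulr_suml scaler_suml.
by apply: eq_bigr => i _; rewrite linearZ tensZl actZl wh scalerA mulrA.
Qed.

(** Only operators of weight a with -a in the cone of simple roots are used, so that lam - mu
    visibly lies in this cone; stability under all of g[t] is [weight_act]. *)
Inductive weight_vec : dual H -> M -> Prop :=
| weight_gen : weight_vec lam w
| weight0 mu : weight_vec mu 0
| weightD mu u v : weight_vec mu u -> weight_vec mu v -> weight_vec mu (u + v)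
| weightZ mu c v : weight_vec mu v -> weight_vec mu (c *: v)
| weight_lower mu a x (p : nat) v : in_root_space a x -> nat_comb alpha (- a) ->
    weight_vec mu v -> weight_vec (mu + a) (act (x ⊗t^ p) v).

(** x is commuted to the right past the lowering operators until it reaches w. *)
Lemma weight_act mu v b x (p : nat) : weight_vec mu v -> in_root_space b x ->
  weight_vec (mu + b) (act (x ⊗t^ p) v).
Proof.
move=> hv; elim: hv b x p =>
  {mu v} [|mu|mu u v _ hu _ hv|mu c v _ hv|mu a y q v hy ca hv IH] b x p hx.
- have [x0|b0|hb|[_ cb]] := root_space_cases hx.
  + by rewrite x0 tens0l act0l; apply: weight0.
  + move: hx; rewrite b0 addr0 => /root_space_csa[h ->].
    by rewrite act_csa; apply/weightZ/weight_gen.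
  + by rewrite (act_pos_root _ hb hx); apply: weight0.
  + exact: weight_lower weight_gen.
- by rewrite act0r; apply: weight0.
- by rewrite actDr; apply: weightD; [apply: hu|apply: hv].
- by rewrite actZr; apply/weightZ/hv.
- rewrite actC lie_tens -exprD; apply: weightD.
    by rewrite -addrA [a + b]addrC; apply/IH/root_space_lie.
  by rewrite addrAC; apply: weight_lower => //; apply: IH.
Qed.

Lemma weight_eigen mu v h : weight_vec mu v -> act (vsval h ⊗ 1) v = (mu h : C) *: v.
Proof.
elim=> {mu v} [|mu|mu u v _ hu _ hv|mu c v _ hv|mu a y q v hy ca hv IH].
- by rewrite -[_ ⊗ 1]/(_ ⊗t^ 0) act_csa mulr1.
- by rewrite act0r scaler0.
- by rewrite actDr hu hv scalerDr.
- by rewrite actZr hv !scalerA mulrC.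
- by rewrite actC lie_tens mul1r IH actZr hy tensZl actZl -scalerDl add_lfunE addrC.
Qed.

Lemma nat_combD a b : nat_comb alpha a -> nat_comb alpha b -> nat_comb alpha (a + b).
Proof.
move=> [k ->] [k' ->]; exists (fun i => k i + k' i)%N.
by rewrite -big_split; apply: eq_bigr => i _; rewrite natrD scalerDl.
Qed.

Lemma weight_comb mu v : weight_vec mu v -> v != 0 -> nat_comb alpha (lam - mu).
Proof.
elim=> {mu v} [|mu|mu u v _ hu _ hv|mu c v _ hv|mu a y q v hy ca hv IH].
- by rewrite subrr; exists (fun=> 0%N); rewrite big1 // => i _; rewrite scale0r.
- by rewrite eqxx.
- have [->|/hu //] := eqVneq u 0; by rewrite add0r.
- by rewrite scaler_eq0 negb_or => /andP[_ /hv].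
- move=> h; rewrite opprD addrA; apply: nat_combD => //; apply: IH.
  by apply: contraNneq h => ->; rewrite act0r.
Qed.

(** Nilpotency holds on w, and passes to x v because ad x_i^- is locally nilpotent on g[t]. *)
Lemma xm_simple_nilpotent i v : exists k, iter k (act (xm X (alpha i) ⊗ 1)) v = 0.
Proof.
set y := xm X (alpha i).
have ad_nil x : exists k, iter k (lie y) x = 0.
  have [_ _ h3] := pos_root_sl2 (pos_simple_root i).
  elim/(@root_space_ind _ _ X): x => [|x z [j hj] [k hk]|a x hx].
  - by exists 0%N.
  - exists (j + k)%N; transitivity (iter (j + k) (lie y) x + iter (j + k) (lie y) z).
      exact: (@iter_actD _ _ (adjoint g)).
    rewrite (@iter_act_ge _ _ (adjoint g) _ _ _ _ (leq_addr k j) hj) add0r.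
    exact: (@iter_act_ge _ _ (adjoint g) _ _ _ _ (leq_addl j k) hk).
  - apply: (raise_to_zero (ad_semisimple_csa (coroot (alpha i))) (d := -2)).
    + by rewrite scaleNr.
    + by rewrite oppr_eq0 pnatr_eq0.
    + exact: hx.
elim/wgen_ind: v => [||u v [j hj] [k hk]|c v [k hk]|x v [k hk]].
- by exists (pairing lam (alpha i)).+1.
- by exists 0%N.
- exists (j + k)%N; rewrite iter_actD.
  by rewrite (iter_act_ge (leq_addr k j) hj) (iter_act_ge (leq_addl j k) hk) addr0.
- by exists k; rewrite iter_act_scale hk scaler0.
have [m ->] := tens_decomp x; rewrite act_suml.
elim/big_rec: _ => [|p u _ [j hj]]; first by exists 0%N.
have [l hl] := ad_nil (x p).
have hl' : iter l (lie (y ⊗ 1)) (x p ⊗t^ p) = 0.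
  suff -> : iter l (lie (y ⊗ 1)) (x p ⊗t^ p) = iter l (lie y) (x p) ⊗t^ p.
    by rewrite hl tens0l.
  by elim: (l) => //= q ->; rewrite lie_tens mul1r.
exists (l + k + j)%N; rewrite iter_actD.
rewrite (iter_act_ge (leq_addr j _) (iter_act_lie_eq0 hl' hk)).
by rewrite (iter_act_ge (leq_addl _ j) hj) addr0.
Qed.

(* The right-hand side is (lam, lam) - (mu, mu).  Reflecting mu in a simple root with
   mu(h_i) < 0 gives a higher weight with the same value, and the value is
   nonnegative when mu is dominant. *)
Lemma weight_norm_le m mu v : weight_vec mu v -> v != 0 -> height (lam - mu) = m%:R ->
  0 <= 2 * kform lam (lam - mu) - kform (lam - mu) (lam - mu).
Proof.
elim/ltn_ind: m mu v => m IH mu v hv v0 hm.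
have [k ek] := weight_comb hv v0.
have hz i : exists z : int, mu (coroot (alpha i)) = z%:~R :> C.
  have [d hd] := dom i.
  have [f hf] := choice (fun j => simple_coroot_int i j).
  exists (d%:Z - \sum_j (k j)%:Z * f j).
  have -> : mu = lam - (lam - mu) by rewrite opprB addrCA subrr addr0.
  rewrite add_lfunE opp_lfunE hd intrB ek dual_sumE; congr (_ - _).
  rewrite rmorph_sum; apply: eq_bigr => j _.
  by rewrite /= scale_lfunE hf intrM.
have [hpos|] := pselect (forall i, 0 <= (mu (coroot (alpha i)) : C)).
  have -> : 2 * kform lam (lam - mu) - kform (lam - mu) (lam - mu) =
      kform (lam + mu) (lam - mu).
    rewrite -mulN1r -kformZl -kformZl -kformDl; congr kform.
    by rewrite scaleN1r opprB scaler_nat mulr2n addrACA subrr addr0 addrC.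
  rewrite ek kform_sumr; apply: sumr_ge0 => i _; have hi := pos_simple_root i.
  rewrite kformZr kformC kform_coroot // !mulr_ge0 ?ler0n //.
  - by rewrite ltW // kform_pos.
  - by rewrite invr_ge0 ler0n.
  - by have [d hd] := dom i; rewrite add_lfunE addr_ge0 // hd ler0n.
move=> /existsNP[i hi].
have [[z|q] hq] := hz i; first by case: hi; rewrite hq ler0n.
move: hq; rewrite NegzE mulrNz => hq; set q1 := q.+1 in hq *.
have hsi := pos_simple_root i; have [h1 h2 h3] := pos_root_sl2 hsi.
(* With q1 = -mu(h_i) > 0, u has the reflected weight mu + q1 alpha_i; it is nonzero because e^q1 is
   injective on vectors of weight -q1. *)
pose u := iter q1 (act (xp X (alpha i) ⊗ 1)) v.
have u0 : u != 0.
  have [l hl] := xm_simple_nilpotent i v.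
  apply: contraNneq v0 => uz; apply/eqP.
  apply: (@sl2_raise_inj _ _ M (xp X (alpha i) ⊗ 1) (cow (alpha i) ⊗ 1)
    (xm X (alpha i) ⊗ 1) q1 l) => //.
  - by rewrite lie_tens mulr1 h1.
  - by rewrite lie_tens mulr1 h2 tensZl.
  - by rewrite lie_tens mulr1 h3 tensNl tensZl.
  - by rewrite (weight_eigen _ hv) hq.
have [_ hxi _] := xpP hsi.
have hu : weight_vec (mu + q1%:R *: alpha i) u.
  rewrite /u; elim: (q1) => [|r hr]; first by rewrite scale0r addr0.
  rewrite iterS mulrSr scalerDl scale1r addrA; exact: (weight_act 0).
have eg : lam - (mu + q1%:R *: alpha i) = (lam - mu) - q1%:R *: alpha i.
  by rewrite opprD addrA.
have hh : height (lam - (mu + q1%:R *: alpha i)) = m%:R - q1%:R.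
  rewrite eg heightD hm heightN; congr (_ - _).
  rewrite scaler_nat; elim: (q1) => [|r hr].
    by rewrite mulr0n /height big1 // => j _; rewrite /simple_coord linear0.
  by rewrite mulrSr heightD hr height_alpha mulrSr.
have [k' ek'] := weight_comb hu u0.
have hh' : height (lam - (mu + q1%:R *: alpha i)) = (\sum_j k' j)%N%:R.
  by rewrite ek' height_comb.
have lt : (\sum_j k' j < m)%N.
  have : (\sum_j k' j + q1)%N%:R = m%:R :> C by rewrite natrD -hh' hh subrK.
  by move=> /eqP; rewrite eqr_nat => /eqP <-; rewrite /q1 addnS ltnS leq_addr.
have := IH _ lt _ _ hu u0 hh'; rewrite eg.
suff -> : 2 * kform lam (lam - mu - q1%:R *: alpha i) -
    kform (lam - mu - q1%:R *: alpha i) (lam - mu - q1%:R *: alpha i) =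
    2 * kform lam (lam - mu) - kform (lam - mu) (lam - mu) by [].
set ga := lam - mu.
have emu : kform (alpha i) lam = kform (alpha i) ga + kform (alpha i) mu.
  by rewrite -kformDr /ga subrK.
have qmu : kform (alpha i) mu = kform (alpha i) (alpha i) / 2 * - q1%:R.
  by rewrite kform_coroot // hq.
rewrite -scaleNr -/ga; move: ga emu => ga emu.
rewrite !(kformDl, kformDr, kformZl, kformZr).
rewrite (kformC lam (alpha i)) (kformC ga (alpha i)) emu qmu.
by field.
Qed.

(** Otherwise every lam - k a is a weight, and the norm inequality gives k <= lam(h_a) for every k
    >= 1. *)
Lemma xm_nilpotent a : Rp a -> w != 0 -> exists k, iter k (act (xm X a ⊗ 1)) w = 0.
Proof.
move=> ha w0; apply: contrapT => hn.
have [_ hy _] := xmP ha.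
have kp := kform_pos ha; have [_ ca] := ha.
have hk k : k.+1%:R <= (lam (coroot a) : C).
  pose v := iter k.+1 (act (xm X a ⊗ 1)) w.
  have v0 : v != 0 by apply/eqP => v0; apply: hn; exists k.+1.
  have hv : weight_vec (lam - k.+1%:R *: a) v.
    rewrite /v; elim: (k.+1) => [|r hr].
      by rewrite scale0r subr0; apply: weight_gen.
    rewrite iterS mulrSr scalerDl scale1r opprD addrA; exact: (weight_act 0).
  have e : lam - (lam - k.+1%:R *: a) = k.+1%:R *: a by rewrite opprB addrC subrK.
  have [m hm] : exists m : nat, height (lam - (lam - k.+1%:R *: a)) = m%:R.
    by have [c ->] := weight_comb hv v0; exists (\sum_i c i)%N; rewrite height_comb.
  have := weight_norm_le hv v0 hm; rewrite e !(kformZl, kformZr) kformC kform_coroot //.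
  have -> : 2 * (k.+1%:R * (kform a a / 2 * lam (coroot a))) -
      k.+1%:R * (k.+1%:R * kform a a) =
      k.+1%:R * kform a a * (lam (coroot a) - k.+1%:R) :> C by field.
  by rewrite pmulr_rge0 ?subr_ge0 // mulr_gt0 // ltr0n.
pose r := complex.Re (lam (coroot a) : C).
have := hk (Num.truncn r); rewrite lecE Re_natr => /andP[_].
by rewrite leNgt truncnS_gt.
Qed.

(** w is a highest weight vector for the sl_2 of a, so nilpotency with some exponent yields the
    exponent lam(h_a) + 1. *)
Lemma xm_nilpotency a : Rp a -> iter (pairing lam a).+1 (act (xm X a ⊗ 1)) w = 0.
Proof.
move=> ha; have [->|w0] := eqVneq w 0; first by rewrite iter_act0.
have [k hk] := xm_nilpotent ha w0; have [h1 h2 h3] := pos_root_sl2 ha.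
have [_ hx _] := xpP ha.
have [||||n [_ hn hf]] := @sl2_highest_weight _ _ M
  (xp X a ⊗ 1) (cow a ⊗ 1) (xm X a ⊗ 1) _ _ w (lam (coroot a)) k w0 _ _ hk.
- by rewrite lie_tens mulr1 h1.
- by rewrite lie_tens mulr1 h3 tensNl tensZl.
- exact: act_pos_root hx.
- exact: (weight_eigen _ weight_gen).
suff -> : pairing lam a = n by [].
by rewrite /pairing hn /natC Re_natr natrK.
Qed.

End HighestWeight.

(** * Comparison of the three submodules *)

Section Quotients.
Variables (K : fieldType) (L : lieAlgType K) (M : lieModType L).
Implicit Types (S T : set M) (u v w : M).

Lemma gen_submod_sub S T : (forall v, S v -> gen_submod T v) ->
  forall v, gen_submod S v -> gen_submod T v.
Proof.
move=> h v; elim=> {v} [v /h //||u v _ hu _ hv|c v _ hv|x v _ hv].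
- exact: gen_submod0.
- exact: gen_submodD.
- exact: gen_submodZ.
- exact: gen_submod_act.
Qed.

Lemma proj_mod_iter S x n v :
  proj_mod S (iter n (act x) v) = iter n (act x) (proj_mod S v).
Proof. by elim: n => //= n <-; rewrite proj_mod_act. Qed.

Lemma proj_mod0 S : proj_mod S 0 = 0.
Proof. by apply/proj_mod_eq0; apply: gen_submod0. Qed.

Definition quot_map S T (q : quot_mod S) : quot_mod T := proj_mod T (repr q).

Lemma quot_mapE S T v : (forall v, gen_submod S v -> gen_submod T v) ->
  quot_map T (proj_mod S v) = proj_mod T v.
Proof. by move=> ST; apply/proj_modP/ST/repr_modP. Qed.

Lemma quot_map_hom S T : (forall v, gen_submod S v -> gen_submod T v) ->
  lie_hom (@quot_map S T).
Proof.
move=> ST; split=> [c p q|x p].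
  have [u ->] := proj_mod_surj p; have [v ->] := proj_mod_surj q.
  by rewrite -proj_modZ -proj_modD !quot_mapE // proj_modD proj_modZ.
have [u ->] := proj_mod_surj p.
by rewrite -proj_mod_act !quot_mapE // proj_mod_act.
Qed.

End Quotients.

Lemma lie_hom_grade (K : numFieldType) (g : lieAlgType K) (M N : lieModType (current g))
    (f : M -> N) (w : M) : lie_hom f -> forall k v, grade w k v -> grade (f w) k (f v).
Proof.
move=> [fl fa] k v.
have f0 : f 0 = 0 by have := fl (-1) 0 0; rewrite scaler0 add0r scaleN1r addNr.
elim=> {k v} [|k|k u v _ hu _ hv|k c v _ hv|k p x v _ hv].
- exact: grade_gen.
- by rewrite f0; apply: grade0.
- by rewrite -[u]scale1r fl scale1r; apply: gradeD.
- by rewrite -[_ *: v]addr0 fl f0 addr0; apply: gradeZ.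
- by rewrite fa; apply: grade_act.
Qed.

Lemma quot_graded_iso (K : numFieldType) (g : lieAlgType K) (M : lieModType (current g))
    (S T : set M) (w : M) : gen_submod S = gen_submod T ->
  graded_iso (grade (proj_mod S w)) (grade (proj_mod T w)) (@quot_map _ _ M S T).
Proof.
move=> e; have ST v : gen_submod S v -> gen_submod T v by rewrite e.
have TS v : gen_submod T v -> gen_submod S v by rewrite e.
have K1 : cancel (@quot_map _ _ M S T) (@quot_map _ _ M T S).
  by move=> p; have [u ->] := proj_mod_surj p; rewrite !quot_mapE.
split; first exact: quot_map_hom.
- exists (@quot_map _ _ M T S) => // p.
  by have [u ->] := proj_mod_surj p; rewrite !quot_mapE.
- move=> k v; split=> [|h].
    by move/(lie_hom_grade (quot_map_hom ST)); rewrite quot_mapE.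
  by rewrite -(K1 v) -(quot_mapE w TS); apply: lie_hom_grade => //; apply: quot_map_hom.
Qed.

Lemma sumn_drop_hook k t D m :
  sumn (drop k (rcons (nseq t D) m)) = if (k <= t)%N then ((t - k) * D + m)%N else 0%N.
Proof.
case: ifPn => kt; last by rewrite drop_oversize // size_rcons size_nseq ltnNge.
rewrite drop_rcons ?size_nseq // sumn_rcons drop_nseq sumn_nseq.
by rewrite mulnC.
Qed.

(** * Root strings in quotients of the local Weyl module *)

Section LocalWeyl.
Variables (R : realType) (g : fdLieAlgType R[i]) (X : root_data g).
Variables (l : nat) (lam : dual (csa X)).
Local Notation C := R[i].
Local Notation H := (csa X).
Local Notation Rp := (pos_root (@simple_root _ _ X)).
Local Notation alpha := (@simple_root _ _ X).
Hypotheses (gs : simple_lie g) (l0 : (0 < l)%N) (dom : dominant lam).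
Local Notation w := (wgen lam).
Implicit Types (a : dual H) (S : set (wloc lam)).

Lemma wgen_xp i (f : {poly C}) : act (xp X (alpha i) ⊗ f) w = 0.
Proof.
rewrite /wgen -proj_mod_act; apply/proj_mod_eq0/gen_submod_in.
by left; left; exists i, f.
Qed.

Lemma wgen_coroot i (s : nat) : act (cow (alpha i) ⊗t^ s) w =
  ((lam (coroot (alpha i)) : C) * (s == 0%N)%:R) *: w.
Proof.
apply/eqP; rewrite -subr_eq0 /wgen -proj_mod_act -proj_modZ -proj_modN -proj_modD.
apply/eqP/proj_mod_eq0/gen_submod_in.
by left; right; exists i, s.
Qed.

Lemma wgen_xm i : iter (pairing lam (alpha i)).+1 (act (xm X (alpha i) ⊗ 1)) w = 0.
Proof.
rewrite /wgen -proj_mod_iter; apply/proj_mod_eq0/gen_submod_in.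
by right; exists i.
Qed.

Lemma wgen_generates (P : wloc lam -> Prop) : P w -> P 0 ->
  (forall u v, P u -> P v -> P (u + v)) -> (forall c v, P v -> P (c *: v)) ->
  (forall x v, P v -> P (act x v)) -> forall v, P v.
Proof.
move=> Pw P0 PD PZ PA v; have [u ->] := proj_mod_surj v; have [t ->] := tcls_surj u.
elim: t => [||t ht s hs|c t ht|x t ht] //.
- by rewrite tclsD proj_modD; apply: PD.
- by rewrite tclsZ proj_modZ; apply: PZ.
- by rewrite tclsA proj_mod_act; apply: PA.
Qed.

Section RootString.
Variables (S : set (wloc lam)) (a : dual H).
Hypothesis ha : Rp a.
Let f (p : nat) : current g := xm X a ⊗t^ p.
Let e : current g := xp X a ⊗ 'X.
Let h (p : nat) : current g := cow a ⊗t^ p.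
Local Notation wS := (proj_mod S w).

Lemma string_ff p q : lie (f p) (f q) = 0.
Proof. by rewrite lie_tens liexx tens0l. Qed.

Lemma string_ef p : lie e (f p) = h p.+1.
Proof. by have [h1 _ _] := pos_root_sl2 ha; rewrite lie_tens h1 -exprS. Qed.

Lemma string_hf p q : lie (h p) (f q) = - (2 *: f (p + q)).
Proof.
by have [_ _ h3] := pos_root_sl2 ha; rewrite lie_tens h3 tensNl tensZl -exprD.
Qed.

Lemma string_ew : act e wS = 0.
Proof.
have [_ hx _] := xpP ha.
by rewrite -proj_mod_act (act_pos_root gs wgen_xp _ ha hx) proj_mod0.
Qed.

Lemma string_hw p : act (h p) wS = ((lam (coroot a) : C) * (p == 0%N)%:R) *: wS.
Proof. by rewrite -proj_mod_act (act_csa wgen_coroot) proj_modZ. Qed.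

Lemma string_hw0 p : act (h p.+1) wS = 0.
Proof. by rewrite string_hw mulr0 scale0r. Qed.

Lemma string_f0w n : (pairing lam a < n)%N -> iter n (act (f 0)) wS = 0.
Proof.
move=> hn; apply: iter_act_ge hn _; rewrite -proj_mod_iter.
have := xm_nilpotency gs dom wgen_xp wgen_coroot wgen_xm wgen_generates ha.
by rewrite -[_ ⊗ 1]/(f 0) => ->; rewrite proj_mod0.
Qed.

(** f_q is up to the factor -2 the bracket of h_a t^(q-p) with f_p, and h_a t^(q-p) acts on w by a
    scalar. *)
Lemma string_fw p q : (p <= q)%N -> act (f p) wS = 0 -> act (f q) wS = 0.
Proof.
move=> pq hp; have := string_hf (q - p) p; rewrite subnK // => e2.
have : act (lie (h (q - p)%N) (f p)) wS = 0.
  by rewrite act_lie hp act0r string_hw actZr hp scaler0 subr0.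
rewrite e2 actNl actZl => /eqP; rewrite oppr_eq0 scaler_eq0 pnatr_eq0 /=.
by move/eqP.
Qed.

Lemma string_garland s r :
  iter s (act e) (iter (s + r) (act (f 0)) wS) = 0 <-> pow_ser f wS r s = 0.
Proof. exact: (garland_eq0 string_ff string_ef string_hf string_ew string_hw0). Qed.

End RootString.

Lemma Dmin_sub_D v : Dmin_rel lam l v -> D_rel lam l v.
Proof.
case=> [[a ha ->]|[a [ha N0 mD ->]]].
  (* N <= s D allows r = 0 in the relation of D for p = s. *)
  exists a, (s_of lam l a), 0%N; split=> //.
  have D0 : (0 < dcoef a * l)%N by rewrite muln_gt0 dcoef_gt0.
  rewrite max0n leqn0 subn_eq0; have [N0|N0] := posnP (pairing lam a).
    by rewrite N0.
  have [t0 eN /andP[_ mD]] : [/\ (0 < s_of lam l a)%N,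
      pairing lam a = ((s_of lam l a - 1) * (dcoef a * l) + m_of lam l a)%N
    & (0 < m_of lam l a <= dcoef a * l)%N] by apply/s_m_unique.
  by rewrite eN [leqRHS]mulnC -{2}(subnK t0) mulnDl mul1n leq_add2l.
have D0 : (0 < dcoef a * l)%N by rewrite muln_gt0 dcoef_gt0.
exists a, (s_of lam l a - 1)%N, (m_of lam l a); split=> //.
have [_ eN _] : [/\ (0 < s_of lam l a)%N,
      pairing lam a = ((s_of lam l a - 1) * (dcoef a * l) + m_of lam l a)%N
    & (0 < m_of lam l a <= dcoef a * l)%N] by apply/s_m_unique.
by rewrite max0n {1}eN [(_ * (dcoef a * l))%N]mulnC addKn.
Qed.

Lemma V_sub_Dmin v : V_rel lam (xi_of lam l) v -> gen_submod (Dmin_rel lam l) v.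
Proof.
move=> [a [s [r [k [[ha s0 r0 k0 hk] ->]]]]]; apply/proj_mod_eq0.
set S := Dmin_rel lam l.
rewrite !proj_mod_iter.
have [Nsr|srN] := ltnP (pairing lam a) (s + r).
  by rewrite (string_f0w S ha Nsr) iter_act0.
apply/(string_garland S ha).
have N0 : (0 < pairing lam a)%N by apply: leq_trans srN; rewrite addn_gt0 s0.
have D0 : (0 < dcoef a * l)%N by rewrite muln_gt0 dcoef_gt0.
have [t0 eN /andP[_ mD]] : [/\ (0 < s_of lam l a)%N,
      pairing lam a = ((s_of lam l a - 1) * (dcoef a * l) + m_of lam l a)%N
    & (0 < m_of lam l a <= dcoef a * l)%N] by apply/s_m_unique.
apply: (pow_ser_eq0_of_top (string_ff a) D0 t0 eN k0 _ _ mD _ _ hk).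
- move=> p /(string_fw ha); apply; rewrite -proj_mod_act.
  by apply/proj_mod_eq0/gen_submod_in; left; exists a.
- move=> mD'; rewrite -proj_mod_iter.
  by apply/proj_mod_eq0/gen_submod_in; right; exists a.
- move=> r' b Nb; apply/(string_garland S ha).
  by rewrite (string_f0w S ha Nb) iter_act0.
(* It remains to see N <= k D + tail: an equality for k <= s - 1, while for k >= s the tail is empty
   and N <= s D <= k D. *)
rewrite /xi_of eqn0Ngt N0 sumn_drop_hook {1}eN.
case: ifPn => ks; first by rewrite addnA -mulnDl subnKC.
rewrite addn0; apply: (@leq_trans ((s_of lam l a - 1).+1 * (dcoef a * l))).
  by rewrite mulSn addnC leq_add2r.
by rewrite leq_mul2r ltnNge ks orbT.
Qed.

Lemma D_sub_V v : D_rel lam l v -> gen_submod (V_rel lam (xi_of lam l)) v.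
Proof.
move=> [a [p [r [ha hr ->]]]]; apply/proj_mod_eq0; set S := V_rel _ _.
rewrite proj_mod_iter; rewrite max0n in hr.
(* The relations of V(xi) require k > 0, so p = 0 is left to the nilpotency of x_a^-. *)
have [p0|p0] := posnP p.
  by rewrite p0; apply: (string_f0w S ha); rewrite p0 muln0 subn0 in hr.
apply: (iter_mode_eq0 (string_ff a) (k := p) (Kk := sumn (drop p (xi_of lam l a)))).
  move=> [|r'] b hb; first by case: b hb.
  (* Since p >= 1, the bound forces b >= 1, as the exponent of x_a^+ t in a relation of V(xi) must
     be positive. *)
  have b0 : (0 < b)%N by nia.
  apply/(string_garland S ha); rewrite -!(proj_mod_iter S).
  apply/proj_mod_eq0/gen_submod_in; by exists a, b, r'.+1, p; split; first by split.
rewrite ltnS; apply: leq_trans hr.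
have D0 : (0 < dcoef a * l)%N by rewrite muln_gt0 dcoef_gt0.
rewrite /xi_of; case: eqP => [->//|/eqP]; rewrite -lt0n => N0.
have [_ eN _] : [/\ (0 < s_of lam l a)%N,
      pairing lam a = ((s_of lam l a - 1) * (dcoef a * l) + m_of lam l a)%N
    & (0 < m_of lam l a <= dcoef a * l)%N] by apply/s_m_unique.
rewrite sumn_drop_hook [leqRHS](congr1 (subn^~ _) eN); case: ifPn => // pt.
by rewrite mulnBl [(p * _)%N]mulnC -addnBAC // mulnC leq_mul2r pt orbT.
Qed.

(** The inclusions of V in Dmin, of Dmin in D and of D in V close a cycle. *)
Lemma gen_V_D : gen_submod (V_rel lam (xi_of lam l)) = gen_submod (D_rel lam l).
Proof.
apply/funext => v; apply/propext; split.
  apply: gen_submod_sub => u /V_sub_Dmin; apply: gen_submod_sub => u' /Dmin_sub_D.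
  exact: gen_submod_in.
by apply: gen_submod_sub => u /D_sub_V.
Qed.

Lemma gen_D_Dmin : gen_submod (D_rel lam l) = gen_submod (Dmin_rel lam l).
Proof.
apply/funext => v; apply/propext; split.
  by apply: gen_submod_sub => u /D_sub_V; apply: gen_submod_sub => u' /V_sub_Dmin.
by apply: gen_submod_sub => u /Dmin_sub_D; apply: gen_submod_in.
Qed.

End LocalWeyl.

Theorem theorem2 (R : realType) (g : fdLieAlgType R[i]) (X : root_data g)
    (l : nat) (lam : dual (csa X)) :
  simple_lie g -> (0 < l)%N -> dominant lam -> lam != 0 ->
  (exists f : Vmod lam (xi_of lam l) -> Dmod lam l,
     graded_iso (grade (Vgen lam (xi_of lam l))) (grade (Dgen lam l)) f)
  /\ gen_submod (D_rel lam l) = gen_submod (Dmin_rel lam l).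
Proof.
move=> gs l0 dom _; split; last exact: gen_D_Dmin.
by eexists; apply: quot_graded_iso; apply: gen_V_D.
Qed.
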